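(* Let $\Bbbk$ be a field, let $\mathcal{P}$ be a finite poset, let $A=\Bbbk\mathcal{P}$ be its incidence algebra, and let $G:=\bigoplus_{I\in\mathbb{I}(\mathcal{P})}V_I$ be the direct sum of all interval modules. Then the global dimension of $\Lambda:=\operatorname{End}_A(G)$ is finite. Hence the interval resolution global dimension of $A$ is finite.
   Context: Modules over the incidence algebra $\Bbbk\mathcal{P}$ are finite-dimensional left modules, and $\operatorname{mod}\Bbbk\mathcal{P}$ is identified with the category of functors $M:\mathcal{P}\to\mathrm{vect}_\Bbbk$ to finite-dimensional vector spaces, where $\mathcal{P}$ is viewed as a category with a unique morphism $p\to q$ whenever $p\le q$. A subset $S\subseteq\mathcal{P}$ is convex if $p,q\in S$ and $p\le x\le q$ imply $x\in S$; it is connected if it is connected as a subgraph of the Hasse diagram of $\mathcal{P}$. An interval is a (nonempty) connected convex subset, and $\mathbb{I}(\mathcal{P})$ is the set of all intervals. For $I\in\mathbb{I}(\mathcal{P})$ the interval module $V_I$ is given by $V_I(x)=\Bbbk$ for $x\in I$, $V_I(x)=0$ otherwise, with $V_I(x\to y)$ the identity for $x\le y$ in $I$ (and zero otherwise). $\operatorname{End}_A(G)$ denotes the algebra $(\operatorname{Hom}_A(G,G),\circ)^{\mathrm{op}}$, so that $\operatorname{Hom}_A(G,M)$ is a left $\Lambda$-module. Let $\mathcal{I}=\operatorname{add}G$ (direct summands of finite direct sums of copies of $G$). A right $\mathcal{I}$-approximation of $M\in\operatorname{mod}A$ is a morphism $f:X\to M$ with $X\in\mathcal{I}$ such that every morphism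 $Y\to M$ with $Y\in\mathcal{I}$ factors through $f$. An interval resolution of $M$ is a sequence $\cdots\to X_1\xrightarrow{f_1}X_0\xrightarrow{f_0}M\to 0$ where $f_0$ is a right $\mathcal{I}$-approximation of $M$ and, for each $i\ge1$, $f_i$ is (induces) a right $\mathcal{I}$-approximation of $\operatorname{Ker}f_{i-1}$. The interval resolution dimension of $M$ is the least $n\ge 0$ such that $M$ has an interval resolution of the form $0\to X_n\to\cdots\to X_0\to M\to0$ (and $\infty$ if there is none). The interval resolution global dimension of $A$ is the supremum of the interval resolution dimensions of all $M\in\operatorname{mod}A$. *)

(* Defs.v *)
From HB Require Import structures.
From mathcomp Require Import all_boot all_order all_algebra.
From mathcomp Require Import boolp.

Set Implicit Arguments.
Unset Strict Implicit.
Unset Printing Implicit Defensive.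

Import Order.TTheory GRing.Theory.
Local Open Scope ring_scope.

Section Intervals.
Context {d : Order.disp_t} {P : finPOrderType d}.
Implicit Types S : {set P}.

Definition poset_convex S : bool :=
  [forall p in S, forall q in S, forall x, (p <= x <= q)%O ==> (x \in S)].

Definition covers (p q : P) : bool :=
  (p < q)%O && ~~ [exists x, (p < x < q)%O].

Definition hasse_edge : rel P := [rel p q | covers p q || covers q p].

Definition poset_connected S : bool :=
  [forall p in S, forall q in S,
     connect [rel x y | [&& x \in S, y \in S & hasse_edge x y]] p q].

Definition is_interval S : bool :=
  [&& S != set0, poset_connected S & poset_convex S].

End Intervals.

Definition poset_interval {d : Order.disp_t} (P : finPOrderType d) :=
  {S : {set P} | is_interval S}.

Record rep (k : fieldType) {d : Order.disp_t} (P : finPOrderType d) := Rep {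
  rep_obj :> P -> vectType k;
  rep_map : forall p q : P, (p <= q)%O -> 'Hom(rep_obj p, rep_obj q);
  rep_map_id : forall (p : P) (h : (p <= p)%O), rep_map h = \1%VF;
  rep_map_comp : forall (p q r : P)
    (hpq : (p <= q)%O) (hqr : (q <= r)%O) (hpr : (p <= r)%O),
    rep_map hpr = (rep_map hqr \o rep_map hpq)%VF }.

Arguments rep_map {k d P} _ {p q} _.

Record rep_hom (k : fieldType) {d : Order.disp_t} {P : finPOrderType d}
    (M N : rep k P) := MkHom {
  hom_app :> forall p : P, 'Hom(M p, N p);
  hom_nat : forall (p q : P) (h : (p <= q)%O),
    (hom_app q \o rep_map M h = rep_map N h \o hom_app p)%VF }.

Section Category.
Context {k : fieldType} {d : Order.disp_t} {P : finPOrderType d}.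
Implicit Types M N L X Y : rep k P.

Lemma hom_eq M N (f g : rep_hom M N) : (forall p, f p = g p) -> f = g.
Proof.
case: f g => [f fn] [g gn] /= fg.
have E : f = g by apply: functional_extensionality_dep.
by case: g / E gn {fg} => gn; congr MkHom; apply: Prop_irrelevance.
Qed.

Definition id_hom M : rep_hom M M.
Proof. by exists (fun p => \1%VF) => p q h; rewrite comp_lfun1l comp_lfun1r. Defined.

Definition comp_hom M N L (g : rep_hom N L) (f : rep_hom M N) : rep_hom M L.
Proof.
exists (fun p => (g p \o f p)%VF) => p q h.
by rewrite -comp_lfunA hom_nat !comp_lfunA hom_nat.
Defined.

Definition zero_hom M N : rep_hom M N.
Proof. by exists (fun p => 0) => p q h; rewrite comp_lfun0l comp_lfun0r. Defined.

Definition opp_hom M N (f : rep_hom M N) : rep_hom M N.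
Proof.
by exists (fun p => - f p) => p q h; rewrite comp_lfunNl comp_lfunNr hom_nat.
Defined.

Definition add_hom M N (f g : rep_hom M N) : rep_hom M N.
Proof.
exists (fun p => f p + g p) => p q h.
by rewrite comp_lfunDl comp_lfunDr !hom_nat.
Defined.

Definition is_iso M N (f : rep_hom M N) : Prop :=
  exists g : rep_hom N M, comp_hom g f = id_hom M /\ comp_hom f g = id_hom N.

Definition isomorphic M N : Prop := exists f : rep_hom M N, is_iso f.

Definition is_zero M : Prop := forall (p : P) (v : M p), v = 0.

Definition zero_rep : rep k P.
Proof.
by exists (fun p => 'rV[k]_0) (fun p q _ => \1%VF) => // *; rewrite comp_lfun1l.
Defined.

Definition dsum_fun M N (p q : P) (h : (p <= q)%O) (v : M p * N p) :
    M q * N q := (rep_map M h v.1, rep_map N h v.2).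

Lemma dsum_fun_is_linear M N (p q : P) (h : (p <= q)%O) :
  linear (@dsum_fun M N p q h).
Proof. by move=> a [u1 u2] [v1 v2]; rewrite /dsum_fun /= !linearP. Qed.

HB.instance Definition _ M N p q h := GRing.isLinear.Build k _ _ _
  (@dsum_fun M N p q h) (@dsum_fun_is_linear M N p q h).

Definition dsum M N : rep k P.
Proof.
exists (fun p => (M p * N p)%type) (fun p q h => linfun (@dsum_fun M N p q h)).
- move=> p h; apply/lfunP => -[u v].
  by rewrite lfunE /= /dsum_fun /= !rep_map_id !id_lfunE.
- move=> p q r hpq hqr hpr; apply/lfunP => -[u v].
  rewrite comp_lfunE !lfunE /= /dsum_fun /=.
  by rewrite (rep_map_comp M hpq hqr hpr) (rep_map_comp N hpq hqr hpr) !comp_lfunE.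
Defined.

Lemma kernel_map_mem M N (f : rep_hom M N) (p q : P) (h : (p <= q)%O)
    (v : subvs_of (lker (f p))) : rep_map M h (vsval v) \in lker (f q).
Proof.
rewrite memv_ker -comp_lfunE hom_nat comp_lfunE.
by have := subvsP v; rewrite memv_ker => /eqP ->; rewrite linear0.
Qed.

Definition kernel M N (f : rep_hom M N) : rep k P.
Proof.
exists (fun p => subvs_of (lker (f p)))
  (fun p q h => (linfun (vsproj (lker (f q))) \o rep_map M h
                 \o linfun (@vsval _ _ (lker (f p))))%VF).
- move=> p h; apply/lfunP => v.
  by rewrite !comp_lfunE !lfunE /= rep_map_id !id_lfunE vsvalK.
- move=> p q r hpq hqr hpr; apply/lfunP => v.
  rewrite !comp_lfunE !lfunE /= vsprojK ?kernel_map_mem //.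
  by rewrite (rep_map_comp M hpq hqr hpr) comp_lfunE.
Defined.

Definition kernel_incl M N (f : rep_hom M N) : rep_hom (kernel f) M.
Proof.
exists (fun p => linfun (@vsval _ _ (lker (f p)))) => p q h.
apply/lfunP => v; rewrite !comp_lfunE !lfunE /= vsprojK //.
exact: kernel_map_mem.
Defined.

End Category.

Arguments zero_rep {k d P}.

Section HomStructures.
Context {k : fieldType} {d : Order.disp_t} {P : finPOrderType d}.
Implicit Types M N : rep k P.

HB.instance Definition _ M N := gen_eqMixin (rep_hom M N).
HB.instance Definition _ M N := gen_choiceMixin (rep_hom M N).

Lemma add_homA M N : associative (@add_hom _ _ _ M N).
Proof. by move=> f g h; apply: hom_eq => p /=; rewrite addrA. Qed.
Lemma add_homC M N : commutative (@add_hom _ _ _ M N).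
Proof. by move=> f g; apply: hom_eq => p /=; rewrite addrC. Qed.
Lemma add_hom0 M N : left_id (zero_hom M N) (@add_hom _ _ _ M N).
Proof. by move=> f; apply: hom_eq => p /=; rewrite add0r. Qed.
Lemma add_homN M N :
  left_inverse (zero_hom M N) (@opp_hom _ _ _ M N) (@add_hom _ _ _ M N).
Proof. by move=> f; apply: hom_eq => p /=; rewrite addNr. Qed.

HB.instance Definition _ M N := GRing.isZmodule.Build (rep_hom M N)
  (@add_homA M N) (@add_homC M N) (@add_hom0 M N) (@add_homN M N).

(* The product of [endo M] is composition: f * g = f \o g. *)
Definition endo M : Type := rep_hom M M.

HB.instance Definition _ M := GRing.Zmodule.on (endo M).

Lemma comp_homA M : associative (fun g f : endo M => comp_hom g f).
Proof. by move=> f g h; apply: hom_eq => p /=; rewrite comp_lfunA. Qed.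
Lemma comp_id_hom M : left_id (id_hom M) (fun g f : endo M => comp_hom g f).
Proof. by move=> f; apply: hom_eq => p /=; rewrite comp_lfun1l. Qed.
Lemma comp_hom_id M : right_id (id_hom M) (fun g f : endo M => comp_hom g f).
Proof. by move=> f; apply: hom_eq => p /=; rewrite comp_lfun1r. Qed.
Lemma comp_homDl M :
  left_distributive (fun g f : endo M => comp_hom g f) +%R.
Proof. by move=> f g h; apply: hom_eq => p /=; rewrite comp_lfunDl. Qed.
Lemma comp_homDr M :
  right_distributive (fun g f : endo M => comp_hom g f) +%R.
Proof. by move=> f g h; apply: hom_eq => p /=; rewrite comp_lfunDr. Qed.

(* Only a possibly trivial ring: M may be zero, e.g. when P is empty. *)
HB.instance Definition _ M := GRing.Zmodule_isPzRing.Build (endo M)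
  (@comp_homA M) (@comp_id_hom M) (@comp_hom_id M)
  (@comp_homDl M) (@comp_homDr M).

End HomStructures.

Section IntervalModules.
Variables (k : fieldType) (d : Order.disp_t) (P : finPOrderType d).

Lemma interval_convex (I : poset_interval P) (p x q : P) :
  p \in val I -> q \in val I -> (p <= x)%O -> (x <= q)%O -> x \in val I.
Proof.
case: I => S /= /and3P[_ _ /forall_inP cS] pS qS px xq.
by move/forall_inP: (cS p pS) => /(_ q qS) /forallP/(_ x); rewrite px xq.
Qed.

(* The space at p is k^1 if p is in I and k^0 otherwise; [pid_mx 1] is the
   identity matrix when both dimensions are 1, and is zero (empty) otherwise. *)
Definition interval_rep (I : poset_interval P) : rep k P.
Proof.
exists (fun p => 'rV[k]_(p \in val I))
  (fun p q _ =>
     linfun (mulmxr (pid_mx 1 : 'M[k]_(p \in val I, q \in val I)))).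
- move=> p h; apply/lfunP => v; rewrite lfunE /= id_lfunE.
  by case: (p \in val I) v => v; rewrite ?[v]thinmx0 ?mul0mx // pid_mx_1 mulmx1.
- move=> p q r hpq hqr hpr; apply/lfunP => v.
  rewrite comp_lfunE !lfunE /= -mulmxA mul_pid_mx.
  have := @interval_convex I p q r.
  case: (p \in val I) v => v; last by rewrite [v]thinmx0 !mul0mx.
  case: (r \in val I); last by rewrite [LHS]thinmx0 [RHS]thinmx0.
  by move=> /(_ isT isT hpq hqr) ->.
Defined.

Definition interval_gen : rep k P :=
  \big[dsum/zero_rep]_(I : poset_interval P) interval_rep I.

(* [^c] is the opposite ring. *)
Definition Lambda : pzRingType := (endo interval_gen)^c.

End IntervalModules.

Section IntervalResolutions.
Context {k : fieldType} {d : Order.disp_t} {P : finPOrderType d}.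
Implicit Types M X Y : rep k P.

Definition in_add (G X : rep k P) : Prop :=
  exists (n : nat) (Y : rep k P),
    isomorphic (dsum X Y) (\big[dsum/zero_rep]_(i < n) G).

Definition right_approx (G X M : rep k P) (f : rep_hom X M) : Prop :=
  in_add G X /\
  forall (Y : rep k P) (g : rep_hom Y M), in_add G Y ->
    exists h : rep_hom Y X, g = comp_hom f h.

Definition induces_kernel_approx (G X Y M : rep k P)
    (f : rep_hom X Y) (g : rep_hom Y M) : Prop :=
  exists f' : rep_hom X (kernel g),
    f = comp_hom (kernel_incl g) f' /\ right_approx G f'.

Record interval_resolution M := IntervalResolution {
  ires_obj : nat -> rep k P;
  ires_aug : rep_hom (ires_obj 0) M;
  ires_map : forall i, rep_hom (ires_obj i.+1) (ires_obj i);
  ires_aug_approx : right_approx (interval_gen k P) ires_aug;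
  ires_map0_approx :
    induces_kernel_approx (interval_gen k P) (ires_map 0) ires_aug;
  ires_map_approx : forall i,
    induces_kernel_approx (interval_gen k P) (ires_map i.+1) (ires_map i) }.

Definition has_interval_resolution M (n : nat) : Prop :=
  exists R : interval_resolution M,
    forall i, (n < i)%N -> is_zero (ires_obj R i).

Definition is_interval_resolution_dim M (n : nat) : Prop :=
  has_interval_resolution M n /\
  forall m, has_interval_resolution M m -> (n <= m)%N.

End IntervalResolutions.

Definition interval_resolution_gldim_finite (k : fieldType)
    (d : Order.disp_t) (P : finPOrderType d) : Prop :=
  exists N : nat, forall M : rep k P,
    exists2 n, (n <= N)%N & is_interval_resolution_dim M n.

Section GlobalDimension.
Context {R : pzRingType}.

Definition projective (Q : lmodType R) : Prop :=
  forall (M N : lmodType R) (g : {linear M -> N}) (f : {linear Q -> N}),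
    (forall y, exists x, g x = y) ->
    exists h : {linear Q -> M}, forall x, f x = g (h x).

Record projective_resolution (M : lmodType R) := ProjectiveResolution {
  pres_obj : nat -> lmodType R;
  pres_aug : {linear pres_obj 0 -> M};
  pres_map : forall i, {linear pres_obj i.+1 -> pres_obj i};
  pres_projective : forall i, projective (pres_obj i);
  pres_aug_surj : forall y, exists x, pres_aug x = y;
  pres_exact0 : forall x, pres_aug x = 0 <-> exists y, pres_map 0 y = x;
  pres_exact : forall i x,
    pres_map i x = 0 <-> exists y, pres_map i.+1 y = x }.

Definition has_projective_resolution (M : lmodType R) (n : nat) : Prop :=
  exists Q : projective_resolution M,
    forall i, (n < i)%N -> forall x : pres_obj Q i, x = 0.

Definition is_projective_dim (M : lmodType R) (n : nat) : Prop :=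
  has_projective_resolution M n /\
  forall m, has_projective_resolution M m -> (n <= m)%N.

End GlobalDimension.

(* The supremum is over all left modules, not only the finitely generated
   ones. *)
Definition gldim_finite (R : pzRingType) : Prop :=
  exists N : nat, forall M : lmodType R,
    exists2 n, (n <= N)%N & is_projective_dim M n.

(* Main.v *)
(** [Lambda] is strongly quasi-hereditary.  Fix an injective rank on [P]
    refining the order, and let [base I] be the element of least rank in an
    interval [I].  The maps into [V_I] that vanish at [base I] are those landing
    in [I \ base I], which is a disjoint union of intervals, so they form a
    projective submodule of [Hom(G, V_I)].  Order intervals by the rank of the
    base point and, for equal base points, by the existence of a map that is
    nonzero there.  This is a strict order because [End(V_I)] consists of
    scalars: a cycle would compose to a nonzero scalar.  If a [Lambda]-module
    [X] is supported on a lower set of intervals with top level [I], a basis of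
    [e_I X] gives a map to [X] from a direct sum of copies of [Hom(G, V_I)]
    whose kernel and cokernel are, up to a projective module, supported on
    fewer intervals; hence the projective dimension of [X] is at most the number
    of intervals.

    For the second claim, an approximation [X -> M] gives an exact sequence
    [0 -> Hom(G, Ker) -> Hom(G, X) -> Hom(G, M) -> 0], so by Schanuel's lemma
    iterated kernels [K] of approximations eventually have [Hom(G, K)]
    projective, and since [G] is a generator this forces [K] to lie in
    [add G]. *)

Require Import Defs.
From mathcomp Require Import all_boot all_order all_algebra.
From HB Require Import structures.
From mathcomp Require Import boolp classical_sets functions.

Set Implicit Arguments.
Unset Strict Implicit.
Unset Printing Implicit Defensive.

Import Order.TTheory GRing.Theory.
Local Open Scope ring_scope.

(** * Projective dimension *)

Section Modules.
Context {R : pzRingType}.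
Implicit Types X Y Z K Q : lmodType R.

(** Many maps below come from [choice] or from an explicit formula; the linear structure is attached
    to them afterwards. *)
Lemma to_linear X Y (f : X -> Y) : linear f -> exists g : {linear X -> Y}, g =1 f.
Proof.
move=> hf.
pose g : {linear X -> Y} :=
  HB.pack f (GRing.isLinear.Build R X Y *:%R f hf).
by exists g.
Qed.

(** * Submodules and quotient modules cut out by a predicate *)

Section Submodule.
Variables (X : lmodType R) (S : X -> Prop).
Hypotheses (S0 : S 0) (SP : forall a x y, S x -> S y -> S (a *: x + y)).

(** Boolean membership has unique proofs, so [val] is injective and equalities can be tested in
    [X]. *)
Local Definition submodule := {x : X | `[< S x >]}.
HB.instance Definition _ := Choice.on submodule.

Local Lemma submodule_val (u : submodule) : S (val u).
Proof. by apply/asboolP; case: u. Qed.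

Local Definition in_submodule x (h : S x) : submodule := exist _ x (introT (asboolP _) h).

Local Lemma submodule_add (u v : submodule) : S (val u + val v).
Proof. by rewrite -[val u]scale1r; apply: SP; apply: submodule_val. Qed.

Local Lemma submodule_scale a (u : submodule) : S (a *: val u).
Proof. by rewrite -[_ *: _]addr0; apply: SP => //; apply: submodule_val. Qed.

Local Lemma submodule_opp (u : submodule) : S (- val u).
Proof. by rewrite -scaleN1r; apply: submodule_scale. Qed.

Local Definition sm_zero := in_submodule S0.
Local Definition sm_add (u v : submodule) := in_submodule (submodule_add u v).
Local Definition sm_opp (u : submodule) := in_submodule (submodule_opp u).
Local Definition sm_scale a (u : submodule) := in_submodule (submodule_scale a u).

Local Fact sm_addA : associative sm_add.
Proof. by move=> u v w; apply: val_inj; rewrite /= addrA. Qed.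
Local Fact sm_addC : commutative sm_add.
Proof. by move=> u v; apply: val_inj; rewrite /= addrC. Qed.
Local Fact sm_add0 : left_id sm_zero sm_add.
Proof. by move=> u; apply: val_inj; rewrite /= add0r. Qed.
Local Fact sm_addN : left_inverse sm_zero sm_opp sm_add.
Proof. by move=> u; apply: val_inj; rewrite /= addNr. Qed.
HB.instance Definition _ :=
  GRing.isZmodule.Build submodule sm_addA sm_addC sm_add0 sm_addN.

Local Fact sm_scaleA a b u : sm_scale a (sm_scale b u) = sm_scale (a * b) u.
Proof. by apply: val_inj; rewrite /= scalerA. Qed.
Local Fact sm_scale1 : left_id 1 sm_scale.
Proof. by move=> u; apply: val_inj; rewrite /= scale1r. Qed.
Local Fact sm_scaleDr : right_distributive sm_scale +%R.
Proof. by move=> a u v; apply: val_inj; rewrite /= scalerDr. Qed.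
Local Fact sm_scaleDl u : {morph sm_scale^~ u : a b / a + b}.
Proof. by move=> a b; apply: val_inj; rewrite /= scalerDl. Qed.
HB.instance Definition _ := GRing.Zmodule_isLmodule.Build R submodule
  sm_scaleA sm_scale1 sm_scaleDr sm_scaleDl.

Lemma submodule_exists : exists (Y : lmodType R) (i : {linear Y -> X}),
  injective i /\ forall x, S x <-> exists y, i y = x.
Proof.
have [i iE] := @to_linear submodule X val (fun a u v => erefl).
exists submodule, i; split; first by move=> u v; rewrite !iE; apply: val_inj.
move=> x; split=> [h|[y <-]]; last by rewrite iE; apply: submodule_val.
by exists (in_submodule h); rewrite iE.
Qed.

(* A quotient class is encoded by its canonical representative, as given by
   the choice operator of [X]. *)
Local Definition rep_of (x : X) : X :=
  choose (fun y => `[< S (x - y) >]) x.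

Local Lemma rep_ofP x : S (x - rep_of x).
Proof.
apply/asboolP; apply: (chooseP (P := fun y => `[< S (x - y) >])).
by rewrite subrr; apply/asboolP.
Qed.

Local Lemma rep_of_eq x y : S (x - y) -> rep_of x = rep_of y.
Proof.
move=> h; rewrite /rep_of.
have E : (fun z => `[< S (x - z) >]) =1 (fun z => `[< S (y - z) >]).
  move=> z; apply/asbool_equiv_eq; split=> h'.
    have -> : y - z = (-1) *: (x - y) + (x - z).
      by rewrite scaleN1r opprB addrA subrK.
    exact: SP.
  by rewrite -[x](subrK y) -addrA -[x - y]scale1r; apply: SP.
rewrite (eq_choose E); apply: choose_id; first by rewrite -E subrr; apply/asboolP.
by rewrite subrr; apply/asboolP.
Qed.

Local Definition quotient := {x : X | rep_of x == x}.
HB.instance Definition _ := Choice.on quotient.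

Local Lemma rep_of_idem x : rep_of (rep_of x) == rep_of x.
Proof.
apply/eqP; apply: rep_of_eq; rewrite -opprB -scaleN1r -[_ *: _]addr0.
by apply: SP => //; apply: rep_ofP.
Qed.

Local Definition proj x : quotient := exist _ (rep_of x) (rep_of_idem x).

Local Lemma proj_val (u : quotient) : proj (val u) = u.
Proof. by apply: val_inj => /=; apply/eqP; case: u. Qed.

Local Lemma projE x y : S (x - y) <-> proj x = proj y.
Proof.
split=> [h|[h]]; first by apply: val_inj; apply: rep_of_eq.
have -> : x - y = (-1) *: (y - rep_of y) + (x - rep_of x).
  by rewrite h scaleN1r opprB [RHS]addrC addrA subrK.
by apply: SP; apply: rep_ofP.
Qed.

Local Lemma proj_lin a x y x' y' : proj x = proj x' -> proj y = proj y' ->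
  proj (a *: x + y) = proj (a *: x' + y').
Proof.
move=> /projE hx /projE hy; apply/projE.
by rewrite opprD addrACA -scalerBr; apply: SP.
Qed.

(** All three operations have the shape [a *: x + y], so that [proj_lin] alone shows independence of
    the representatives. *)
Local Definition qm_add (u v : quotient) := proj (1 *: val u + val v).
Local Definition qm_opp (u : quotient) := proj (-1 *: val u + 0).
Local Definition qm_scale a (u : quotient) := proj (a *: val u + 0).

Local Lemma qm_addE x y : qm_add (proj x) (proj y) = proj (x + y).
Proof. by rewrite -[x in RHS]scale1r; apply: proj_lin; rewrite proj_val. Qed.
Local Lemma qm_oppE x : qm_opp (proj x) = proj (- x).
Proof.
by rewrite -[- x]addr0 -scaleN1r; apply: proj_lin => //; rewrite proj_val.
Qed.
Local Lemma qm_scaleE a x : qm_scale a (proj x) = proj (a *: x).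
Proof. by rewrite -[a *: x]addr0; apply: proj_lin => //; rewrite proj_val. Qed.

Local Fact qm_addA : associative qm_add.
Proof.
move=> u v w; rewrite -[u]proj_val -[v]proj_val -[w]proj_val.
by rewrite !qm_addE addrA.
Qed.
Local Fact qm_addC : commutative qm_add.
Proof.
by move=> u v; rewrite -[u]proj_val -[v]proj_val !qm_addE addrC.
Qed.
Local Fact qm_add0 : left_id (proj 0) qm_add.
Proof. by move=> u; rewrite -[u]proj_val qm_addE add0r. Qed.
Local Fact qm_addN : left_inverse (proj 0) qm_opp qm_add.
Proof. by move=> u; rewrite -[u]proj_val qm_oppE qm_addE addNr. Qed.
HB.instance Definition _ :=
  GRing.isZmodule.Build quotient qm_addA qm_addC qm_add0 qm_addN.

Local Fact qm_scaleA a b u : qm_scale a (qm_scale b u) = qm_scale (a * b) u.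
Proof. by rewrite -[u]proj_val !qm_scaleE scalerA. Qed.
Local Fact qm_scale1 : left_id 1 qm_scale.
Proof. by move=> u; rewrite -[u]proj_val qm_scaleE scale1r. Qed.
Local Fact qm_scaleDr : right_distributive qm_scale +%R.
Proof.
move=> a u v; rewrite -[u]proj_val -[v]proj_val.
by rewrite [_ + _]qm_addE !qm_scaleE [RHS]qm_addE scalerDr.
Qed.
Local Fact qm_scaleDl u : {morph qm_scale^~ u : a b / a + b}.
Proof.
by move=> a b; rewrite -[u]proj_val !qm_scaleE [RHS]qm_addE scalerDl.
Qed.
HB.instance Definition _ := GRing.Zmodule_isLmodule.Build R quotient
  qm_scaleA qm_scale1 qm_scaleDr qm_scaleDl.

Lemma quotient_exists : exists (Q : lmodType R) (p : {linear X -> Q}),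
  (forall y, exists x, p x = y) /\ forall x, p x = 0 <-> S x.
Proof.
have plin : linear (proj : X -> quotient).
  by move=> a x y; rewrite -qm_addE -qm_scaleE.
have [p pE] := to_linear plin.
exists quotient, p; split=> [y|x]; first by exists (val y); rewrite pE proj_val.
by rewrite pE -[0]/(proj 0) -projE subr0.
Qed.

End Submodule.

(** * Exact sequences, splittings and projective modules *)

Definition short_exact X Y Z (f : {linear X -> Y}) (g : {linear Y -> Z}) :=
  [/\ injective f, forall z, exists y, g y = z
    & forall y, g y = 0 <-> exists x, f x = y].

Lemma kernel_exists X Y (f : {linear X -> Y}) :
  exists (K : lmodType R) (i : {linear K -> X}),
    injective i /\ forall x, f x = 0 <-> exists y, i y = x.
Proof.
apply: submodule_exists => [|a x y]; first exact: linear0.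
by rewrite linearP => -> ->; rewrite scaler0 addr0.
Qed.

Lemma image_short_exact X Y (f : {linear X -> Y}) :
  exists (Q : lmodType R) (i : {linear Q -> Y}) (p : {linear X -> Q}),
    injective i /\ (forall q, exists x, p x = q) /\ forall x, i (p x) = f x.
Proof.
have [||Q [i [ii iS]]] := @submodule_exists Y (fun y => exists x, f x = y).
- by exists 0; rewrite linear0.
- by move=> a _ _ [x <-] [y <-]; exists (a *: x + y); rewrite linearP.
have /choice [p pE] x : exists q, i q = f x by apply/iS; exists x.
have [|p' p'E] := @to_linear X Q p.
  by move=> a x y; apply: ii; rewrite linearP !pE linearP.
exists Q, i, p'; split=> //; split=> [q|x]; last by rewrite p'E.
have /iS [x fx] : exists q', i q' = i q by exists q.
by exists x; apply: ii; rewrite p'E pE.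
Qed.

Lemma lift_injective X Y Z (i : {linear Y -> Z}) (f : {linear X -> Z}) :
  injective i -> (forall x, exists y, i y = f x) ->
  exists g : {linear X -> Y}, forall x, i (g x) = f x.
Proof.
move=> ii /choice [g gE]; have [|g' g'E] := @to_linear X Y g.
  by move=> a x y; apply: ii; rewrite linearP !gE linearP.
by exists g' => x; rewrite g'E.
Qed.

Lemma splitting_projective X Y (p : {linear X -> Y}) : projective Y ->
  (forall y, exists x, p x = y) -> exists s : {linear Y -> X}, forall y, p (s y) = y.
Proof. by move=> hY ps; have [s sE] := hY X Y p idfun ps; exists s => y; rewrite -sE. Qed.

(** [y - s (g y)] is killed by [g], so it comes from a unique element of [X]. *)
Lemma split_retraction X Y Z (f : {linear X -> Y}) (g : {linear Y -> Z})
    (s : {linear Z -> Y}) : short_exact f g -> (forall z, g (s z) = z) ->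
  exists r : {linear Y -> X}, forall y, f (r y) = y - s (g y).
Proof.
move=> [fi _ fg] gs.
have [|h hE] := @to_linear Y Y (fun y => y - s (g y)).
  by move=> a x y; rewrite (linearP g) (linearP s) opprD addrACA -scalerBr.
have [|r rE] := lift_injective (f := h) fi; last by exists r => y; rewrite rE hE.
by move=> y; apply/fg; rewrite hE linearB gs subrr.
Qed.

Lemma retract_projective X Y (i : {linear X -> Y}) (r : {linear Y -> X}) :
  (forall x, r (i x) = x) -> projective Y -> projective X.
Proof.
move=> ri hY M N g f gs; have [h hE] := hY M N g (f \o r) gs.
by exists (h \o i) => x; rewrite /= -hE /= ri.
Qed.

(** The easy half of the dual basis lemma: lift the images of the [b j] and extend by the
    coordinates [a j]. The projectivity of Hom(G, M) and of its submodules of vanishing maps rests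
    on it. *)
Lemma dual_basis_projective (n : Type) (s : seq n) X (b : n -> X)
    (a : n -> {linear X -> R^o}) :
  (forall x, x = \sum_(j <- s) (a j x : R) *: b j) -> projective X.
Proof.
move=> xE M N g f gs.
have /choice [m mE] j : exists m, g m = f (b j) by apply: gs.
have [|h hE] := @to_linear X M (fun x => \sum_(j <- s) (a j x : R) *: m j).
  move=> c x y; rewrite scaler_sumr -big_split /=; apply: eq_bigr => j _.
  by rewrite linearP /= scalerDl scalerA.
exists h => x; rewrite hE linear_sum {1}[x]xE linear_sum.
by apply: eq_bigr => j _; rewrite !linearZ /= mE.
Qed.

Lemma pair_projective X Y : projective X -> projective Y ->
  projective (X * Y)%type.
Proof.
move=> hX hY M N g f gs.
have lX : linear (fun x : X => f (x, 0)).
  by move=> a x y; rewrite -linearP; congr (f (_, _)); rewrite /= scaler0 addr0.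
have lY : linear (fun y : Y => f (0, y)).
  by move=> a x y; rewrite -linearP; congr (f (_, _)); rewrite /= scaler0 addr0.
have [fX fXE] := to_linear lX; have [fY fYE] := to_linear lY.
have [h1 h1E] := hX M N g fX gs; have [h2 h2E] := hY M N g fY gs.
have [|h hE] := @to_linear (X * Y)%type M (fun u => h1 u.1 + h2 u.2).
  by move=> a u v; rewrite !linearP /= scalerDr addrACA.
exists h => -[x y]; rewrite hE linearD -h1E -h2E fXE fYE -linearD.
by congr (f (_, _)); rewrite /= ?addr0 ?add0r.
Qed.

Lemma zero_projective X : (forall x : X, x = 0) -> projective X.
Proof.
move=> X0; apply: (@dual_basis_projective void [::] _ (fun=> 0) (fun=> \0)).
by move=> x; rewrite big_nil.
Qed.

(** Bounding the dimension by successive syzygies allows induction on [n]; [pd_le_has_resolution]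
    converts the bound back into a resolution. *)
Fixpoint pd_le (n : nat) X : Prop :=
  if n is m.+1 then
    exists (K Q : lmodType R) (i : {linear K -> Q}) (p : {linear Q -> X}),
      [/\ projective Q, short_exact i p & pd_le m K]
  else projective X.

Lemma pd_le_projective n X : projective X -> pd_le n X.
Proof.
elim: n X => // n IH X hX.
pose Z : lmodType R := 'rV[R]_0.
have Z0 (z : Z) : z = 0 by rewrite [z]thinmx0.
exists Z, X, \0, idfun; split=> //; last exact/IH/zero_projective.
split=> [x y _|y|y]; first by rewrite [x]Z0 [y]Z0.
  by exists y.
by split=> [y0|[x <-]] //; exists 0; exact: esym y0.
Qed.

Lemma pd_leS n X : pd_le n X -> pd_le n.+1 X.
Proof.
elim: n X => [|n IH] X; first exact: pd_le_projective 1%N X.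
by move=> [K [Q [i [p [hQ ip hK]]]]]; exists K, Q, i, p; split=> //; apply: IH.
Qed.

(** Horseshoe lemma. Covers of [X] and [Z] combine into a cover of [Y] by [QX * QZ] whose kernel is
    an extension of [KZ] by [KX]; for [n = 0] the sequence splits. *)
Lemma pd_le_extension n X Y Z (f : {linear X -> Y}) (g : {linear Y -> Z}) :
  short_exact f g -> pd_le n X -> pd_le n Z -> pd_le n Y.
Proof.
elim: n X Y Z f g => [|n IH] X Y Z f g fg.
  move=> hX hZ M N u v us.
  have [fi gs gf] := fg.
  have [s sE] := splitting_projective hZ gs.
  have [r rE] := split_retraction fg sE.
  have [h1 h1E] := hX M N u (v \o f) us; have [h2 h2E] := hZ M N u (v \o s) us.
  have [|h hE] := @to_linear Y M (fun y => h1 (r y) + h2 (g y)).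
    by move=> a x y; rewrite !linearP /= scalerDr addrACA.
  by exists h => y; rewrite hE linearD -h1E -h2E /= rE -linearD subrK.
have [fi gs gf] := fg.
move=> [KX [QX [iX [pX [hQX eX hKX]]]]] [KZ [QZ [iZ [pZ [hQZ eZ hKZ]]]]].
(* [t] lifts the cover [pZ] of [Z] to [Y]; together with [f \o pX] it gives the cover [p]. *)
have [t tE] := hQZ Y Z g pZ gs.
have [|p pE] := @to_linear (QX * QZ)%type Y (fun u => f (pX u.1) + t u.2).
  by move=> a u v; rewrite !linearP /= scalerDr addrACA.
have [K [i [ii iE]]] := kernel_exists p.
have [iXi pXs eXE] := eX; have [iZi pZs eZE] := eZ.
have gfx x : g (f x) = 0 by apply/gf; exists x.
have gp u : g (p u) = pZ u.2 by rewrite pE linearD gfx add0r -tE.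
exists K, (QX * QZ)%type, i, p; split; first exact: pair_projective.
  split=> // y; have [z zE] := pZs (g y).
  have /gf [x xE] : g (y - t z) = 0 by rewrite linearB -tE zE subrr.
  have [w wE] := pXs x; exists (w, z).
  by rewrite pE /= wE xE subrK.
have lin1 : linear (fun x => (iX x, 0) : (QX * QZ)%type).
  by move=> a x y; rewrite linearP; congr (_, _); rewrite /= scaler0 addr0.
have [j jE] := to_linear lin1.
have [|a aE] := lift_injective (f := j) ii.
  move=> x; apply/iE; rewrite pE jE /= linear0 addr0.
  have -> : pX (iX x) = 0 by apply/eXE; exists x.
  by rewrite linear0.
have [|q qE] := @to_linear K QZ (fun x => (i x).2).
  by move=> c x y; rewrite linearP.
have [|b bE] := lift_injective (f := q) iZi.
  move=> x; apply/eZE; rewrite qE -gp.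
  by have -> : p (i x) = 0; rewrite ?linear0 //; apply/iE; exists x.
(* Exactness of the row of kernels 0 -> KX -> K -> KZ -> 0, by a diagram chase. *)
apply: (IH _ _ _ a b _ hKX hKZ); split.
- move=> x y /(congr1 i); rewrite !aE !jE => -[]; exact: iXi.
- move=> z; have : g (t (iZ z)) = 0 by rewrite -tE; apply/eZE; exists z.
  move=> /gf [x xE]; have [w wE] := pXs x.
  have /iE [y yE] : p (- w, iZ z) = 0 by rewrite pE /= !linearN wE xE addNr.
  by exists y; apply: iZi; rewrite bE qE yE.
- move=> y; split=> [by0|[x <-]]; last first.
    by apply: iZi; rewrite bE qE aE jE linear0.
  have i2 : (i y).2 = 0 by rewrite -qE -bE by0 linear0.
  have : p (i y) = 0 by apply/iE; exists y.
  rewrite pE i2 linear0 addr0 => /eqP; rewrite -[0](linear0 f) => /eqP /fi /eXE [x xE].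
  by exists x; apply: ii; rewrite aE jE xE; case: (i y) i2 => u v /= ->.
Qed.

(** The kernel [L] of the cover [Q -> Y -> Z] is an extension of [X] by [K], which bounds its
    dimension by [n]. *)
Lemma pd_le_cokernel n X Y Z (f : {linear X -> Y}) (g : {linear Y -> Z}) :
  short_exact f g -> pd_le n X -> pd_le n.+1 Y -> pd_le n.+1 Z.
Proof.
move=> [fi gs gf] hX [K [Q [i [p [hQ [ii ps ip] hK]]]]].
have [L [j [ji jE]]] := kernel_exists (g \o p).
exists L, Q, j, (g \o p); split=> //.
  split=> // z; have [y yE] := gs z; have [x xE] := ps y.
  by exists x; rewrite /= xE yE.
have [|a aE] := lift_injective (f := i) ji.
  move=> x; apply/jE => /=.
  by have -> : p (i x) = 0; rewrite ?linear0 //; apply/ip; exists x.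
have [|b bE] := lift_injective (f := p \o j) fi.
  by move=> x; apply/gf/jE; exists x.
apply: (@pd_le_extension n _ _ _ a b _ hK hX); split.
- by move=> x y /(congr1 j); rewrite !aE => /ii.
- move=> x; have [q qE] := ps (f x).
  have /jE [y yE] : (g \o p) q = 0 by rewrite /= qE; apply/gf; exists x.
  by exists y; apply: fi; rewrite bE /= yE.
- move=> y; split=> [by0|[x <-]]; last first.
    by apply: fi; rewrite bE /= aE linear0; apply/ip; exists x.
  have /ip [x xE] : p (j y) = 0 by rewrite -[RHS](linear0 f) -by0 bE.
  by exists x; apply: ji; rewrite aE.
Qed.

(** The sequence splits, so [X] is also the cokernel of a section [Z -> Y], and [pd_le_cokernel]
    applies; for [n = 0] it is a retract of a projective module. *)
Lemma pd_le_summand n X Y Z (f : {linear X -> Y}) (g : {linear Y -> Z}) :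
  short_exact f g -> projective Z -> pd_le n Y -> pd_le n X.
Proof.
move=> fg hZ; have [fi gs gf] := fg.
have [s sE] := splitting_projective hZ gs.
have [r rE] := split_retraction fg sE.
have rf x : r (f x) = x.
  apply: fi; rewrite rE; have -> : g (f x) = 0 by apply/gf; exists x.
  by rewrite linear0 subr0.
case: n => [|n] hY; first exact: retract_projective rf hY.
apply: (@pd_le_cokernel n _ _ _ s r) (pd_le_projective n hZ) hY; split.
- by move=> x y /(congr1 g); rewrite !sE.
- by move=> x; exists (f x).
- move=> y; split=> [ry|[z <-]].
    by exists (g y); apply/eqP; rewrite eq_sym -subr_eq0 -rE ry linear0.
  by apply: fi; rewrite rE sE subrr linear0.
Qed.

(** Schanuel's lemma. The pullback [E] of the two covers of [X] is an extension of [Q] by [K'],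
    which bounds its dimension, and an extension of the projective [Q'] by [K], which makes [K] a
    summand of it. *)
Lemma pd_le_syzygy n K Q X (i : {linear K -> Q}) (p : {linear Q -> X}) :
  short_exact i p -> projective Q -> pd_le n.+1 X -> pd_le n K.
Proof.
move=> ip hQ [K' [Q' [i' [p' [hQ' ip' hK']]]]].
have [ii ps pi] := ip; have [ii' ps' pi'] := ip'.
have [|d dE] := @to_linear (Q * Q')%type X (fun u => p u.1 - p' u.2).
  by move=> a u v; rewrite (linearP p) (linearP p') opprD addrACA -scalerBr.
have [E [j [ji jE]]] := kernel_exists d.
have dj u : p (j u).1 = p' (j u).2.
  by apply/eqP; rewrite -subr_eq0 -dE; apply/eqP/jE; exists u.
have [|a aE] := @to_linear E Q (fun u => (j u).1).
  by move=> c u v; rewrite linearP.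
have [|a' a'E] := @to_linear E Q' (fun u => (j u).2).
  by move=> c u v; rewrite linearP.
have [|b bE] := @to_linear K (Q * Q')%type (fun u => (i u, 0)).
  by move=> c x y; rewrite linearP; congr (_, _); rewrite /= scaler0 addr0.
have [|b' b'E] := @to_linear K' (Q * Q')%type (fun u => (0, i' u)).
  by move=> c x y; rewrite linearP; congr (_, _); rewrite /= scaler0 addr0.
have [|e eE] := lift_injective (f := b) ji.
  move=> x; apply/jE; rewrite dE bE /= linear0 subr0; apply/pi; by exists x.
have [|e' e'E] := lift_injective (f := b') ji.
  by move=> x; apply/jE; rewrite dE b'E /= linear0 sub0r; apply/eqP; rewrite oppr_eq0; apply/eqP/pi'; exists x.
have hE : pd_le n E.
  apply: (@pd_le_extension n _ _ _ e' a) hK' (pd_le_projective n hQ); split.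
  - by move=> x y /(congr1 j); rewrite !e'E !b'E => -[] /ii'.
  - move=> q; have [q' q'E] := ps' (p q).
    have /jE [u uE] : d (q, q') = 0 by rewrite dE /= q'E subrr.
    by exists u; rewrite aE uE.
  - move=> u; split=> [au|[x <-]]; last by rewrite aE e'E b'E.
    have j1 : (j u).1 = 0 by rewrite -aE.
    have /pi' [x xE] : p' (j u).2 = 0 by rewrite -dj j1 linear0.
    by exists x; apply: ji; rewrite e'E b'E xE; case: (j u) j1 => v w /= ->.
apply: (@pd_le_summand n _ _ _ e a') hQ' hE; split.
- by move=> x y /(congr1 j); rewrite !eE !bE => -[] /ii.
- move=> q'; have [q qE] := ps (p' q').
  have /jE [u uE] : d (q, q') = 0 by rewrite dE /= qE subrr.
  by exists u; rewrite a'E uE.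
- move=> u; split=> [au|[x <-]]; last by rewrite a'E eE bE.
  have j1 : (j u).2 = 0 by rewrite -a'E.
  have /pi [x xE] : p (j u).1 = 0 by rewrite dj j1 linear0.
  by exists x; apply: ji; rewrite eE bE xE; case: (j u) j1 => v w /= ->.
Qed.

Lemma projective_has_resolution X :
  projective X -> has_projective_resolution X 0.
Proof.
move=> hX; pose Z : lmodType R := 'rV[R]_0.
have Z0 (z : Z) : z = 0 by rewrite [z]thinmx0.
pose obj i : lmodType R := if i is 0%N then X else Z.
pose mp i : {linear obj i.+1 -> obj i} := \0.
have hobj i : projective (obj i) by case: i => // i; apply: zero_projective.
unshelve eexists (@ProjectiveResolution R X obj idfun mp hobj _ _ _).
- by move=> y; exists y.
- by move=> x; split=> [x0|[y <-]] //; exists 0; exact: esym x0.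
- by move=> i x; split=> // _; exists 0; rewrite [x]Z0.
- by case.
Qed.

(** Splicing: the augmentation of a resolution of [K], followed by [i], becomes the first
    differential. *)
Lemma resolution_step n K Q X (i : {linear K -> Q}) (p : {linear Q -> X}) :
  short_exact i p -> projective Q -> has_projective_resolution K n ->
  has_projective_resolution X n.+1.
Proof.
move=> [ii ps pi] hQ [D D0].
pose obj j : lmodType R := if j is j'.+1 then pres_obj D j' else Q.
pose mp j : {linear obj j.+1 -> obj j} :=
  match j return {linear obj j.+1 -> obj j} with
  | 0%N => i \o pres_aug D
  | j'.+1 => pres_map D j'
  end.
have hobj j : projective (obj j) by case: j => // j; apply: pres_projective.
unshelve eexists (@ProjectiveResolution R X obj p mp hobj ps _ _).
- move=> x; split=> [/pi [y <-]|[y <-]] /=.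
    by have [z <-] := pres_aug_surj D y; exists z.
  by apply/pi; eexists.
- case=> [|j] x /=; last exact: pres_exact.
  rewrite -pres_exact0; split=> [|-> ]; last exact: linear0.
  by rewrite -[0](linear0 i) => /ii.
- by case=> // j jn x; apply: D0.
Qed.

Lemma pd_le_has_resolution n X : pd_le n X -> has_projective_resolution X n.
Proof.
elim: n X => [|n IH] X; first exact: projective_has_resolution.
by move=> [K [Q [i [p [hQ ip /IH hK]]]]]; apply: resolution_step ip hQ hK.
Qed.

End Modules.

(** Both dimensions are defined as attained minima, so an upper bound has to be turned into a least
    value. *)
Lemma least_witness (P : nat -> Prop) N : P N ->
  exists2 n, (n <= N)%N & P n /\ forall m, P m -> (n <= m)%N.
Proof.
move=> PN; have exP : exists n, `[< P n >] by exists N; apply/asboolP.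
have [n /asboolP Pn nmin] := ex_minnP exP.
by exists n; [|split=> // m Pm]; apply: nmin; apply/asboolP.
Qed.

Lemma pd_le_gldim_finite (R : pzRingType) N :
  (forall X : lmodType R, pd_le N X) -> gldim_finite R.
Proof.
move=> h; exists N => X; apply: least_witness.
exact/pd_le_has_resolution/h.
Qed.

(** * Direct powers, bases and the stratification argument *)

Section FiniteSupport.
Variable T : eqType.

Definition finsupp (V : nmodType) (F : T -> V) :=
  exists s : seq T, forall b, b \notin s -> F b = 0.

(** The value uses some chosen support list, with repetitions removed; [fsumE] shows that the choice
    does not matter. The value 0 is a default for families of infinite support. *)
Definition fsum (V : nmodType) (F : T -> V) : V :=
  if pselect (finsupp F) is left h then \sum_(b <- undup (sval (cid h))) F b
  else 0.

Lemma fsumE (V : nmodType) (F : T -> V) (s : seq T) :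
  uniq s -> (forall b, b \notin s -> F b = 0) -> fsum F = \sum_(b <- s) F b.
Proof.
move=> us sF; rewrite /fsum; case: pselect => [h|[]]; last by exists s.
case: (cid h) => s' /= s'F.
rewrite (bigID (fun b => F b == 0)) [RHS](bigID (fun b => F b == 0)) /=.
rewrite big1 ?add0r; last by move=> ? /eqP.
rewrite [X in _ = X + _]big1 ?add0r; last by move=> ? /eqP.
rewrite -[LHS]big_filter -[RHS]big_filter; apply/perm_big/uniq_perm.
- by rewrite filter_uniq ?undup_uniq.
- by rewrite filter_uniq.
- move=> b; rewrite !mem_filter mem_undup; case: (F b =P 0) => //= Fb.
  apply/idP/idP => [_|_]; first by case: (boolP (b \in s)) => // /sF.
  by case: (boolP (b \in s')) => // /s'F.
Qed.

Lemma finsupp_uniq (V : nmodType) (F : T -> V) : finsupp F ->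
  exists2 s : seq T, uniq s & forall b, b \notin s -> F b = 0.
Proof.
move=> [s sF]; exists (undup s); first exact: undup_uniq.
by move=> b; rewrite mem_undup; apply: sF.
Qed.

Lemma finsupp_uniq2 (V V' : nmodType) (F : T -> V) (F' : T -> V') :
  finsupp F -> finsupp F' -> exists s : seq T,
  [/\ uniq s, forall b, b \notin s -> F b = 0 & forall b, b \notin s -> F' b = 0].
Proof.
move=> [s sF] [s' sF']; exists (undup (s ++ s')); split; first exact: undup_uniq.
  by move=> b; rewrite mem_undup mem_cat negb_or => /andP[/sF].
by move=> b; rewrite mem_undup mem_cat negb_or => /andP[_ /sF'].
Qed.

Context {R : pzRingType}.

Lemma fsum_linear (X Y : lmodType R) (h : T -> {linear X -> Y}) a
    (F F' : T -> X) : finsupp F -> finsupp F' ->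
  fsum (fun b => h b (a *: F b + F' b)) =
  a *: fsum (fun b => h b (F b)) + fsum (fun b => h b (F' b)).
Proof.
move=> fF fF'; have [s [us sF sF']] := finsupp_uniq2 fF fF'.
rewrite (fsumE us) => [|b bs]; last first.
  by rewrite sF ?sF' ?scaler0 ?addr0 ?linear0.
rewrite (fsumE us) => [|b bs]; last by rewrite sF ?linear0.
rewrite (fsumE us) => [|b bs]; last by rewrite sF' ?linear0.
by rewrite scaler_sumr -big_split; apply: eq_bigr => b _; rewrite linearP.
Qed.

(** The direct sum of [T] copies of [M], realised inside the product. The index set may be infinite,
    as the modules are not assumed finitely generated. *)
Lemma power_exists (M : lmodType R) :
  exists (D : lmodType R) (j : {linear D -> (T -> M)}),
    injective j /\ forall F, finsupp F <-> exists d, j d = F.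
Proof.
apply: submodule_exists; first by exists [::].
move=> a F F' fF fF'; have [s [_ sF sF']] := finsupp_uniq2 fF fF'.
exists s => b bs; have -> : (a *: F + F') b = a *: F b + F' b by [].
by rewrite (sF b bs) (sF' b bs) addr0 scaler0.
Qed.

Lemma power_map (M D : lmodType R) (j : {linear D -> (T -> M)})
    (Y : lmodType R) (h : T -> {linear M -> Y}) :
  (forall d, finsupp (j d)) ->
  exists g : {linear D -> Y}, forall d, g d = fsum (fun b => h b (j d b)).
Proof.
move=> jf; have [|g gE] := @to_linear R D Y (fun d => fsum (fun b => h b (j d b))).
  move=> a d d'; rewrite -fsum_linear //; congr fsum; apply/funext => b.
  by rewrite linearP.
by exists g.
Qed.

(** Lift on each summand separately and add up; the sums are finite because the supports are. *)
Lemma power_projective (M D : lmodType R) (j : {linear D -> (T -> M)}) :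
  injective j -> (forall F, finsupp F <-> exists d, j d = F) ->
  projective M -> projective D.
Proof.
move=> ij jF hM N N' g f gs.
have jf d : finsupp (j d) by apply/jF; exists d.
(* The inclusion of the summand at [b]. *)
have single b : exists u : {linear M -> D},
    forall m b', j (u m) b' = if b' == b then m else 0.
  have lin : linear (fun m b' => if b' == b then m else 0 : M).
    move=> a m m'; apply/funext => b'.
    transitivity (a *: (if b' == b then m else 0) + (if b' == b then m' else 0)) => //.
    by case: eqP => // _; rewrite scaler0 addr0.
  have [u uE] := @to_linear R M (T -> M) _ lin.
  have [|v vE] := lift_injective (f := u) ij.
    move=> m; apply/jF; exists [:: b] => b'; rewrite uE inE.
    by case: (b' == b).
  by exists v => m b'; rewrite vE uE.
have [u uE] := choice single.
have /choice [h hE] b : exists h : {linear M -> N}, forall m, f (u b m) = g (h m).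
  by have [h hE] := hM _ _ g (f \o u b) gs; exists h => m; rewrite -hE.
have [l lE] := power_map h jf.
exists l => d; rewrite lE; have [s us sd] := finsupp_uniq (jf d).
rewrite (fsumE us) => [|b bs]; last by rewrite sd ?linear0.
rewrite linear_sum -(eq_bigr _ (fun b _ => hE b (j d b))) -linear_sum.
(* What remains is that [d] is the sum of its components, checked at each index. *)
congr (f _); apply: ij; rewrite linear_sum; apply/funext => b.
rewrite fct_sumE; under eq_bigr do rewrite uE.
case: (boolP (b \in s)) => bs.
  rewrite (bigD1_seq b) //= eqxx big1 ?addr0 // => b' b'b.
  by rewrite eq_sym (negPf b'b).
rewrite sd // big_seq big1 // => b' b's; case: eqP => // bb'.
by rewrite -bb' (negPf bs) in b's.
Qed.

End FiniteSupport.

(** * Linear bases from Zorn's lemma, for a field acting through [c_] *)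

Section Basis.
Variables (k : fieldType) (R : pzRingType) (c_ : {rmorphism k -> R}).
Variables (X : lmodType R) (W : set X).

Definition lcomb (s : seq X) (a : X -> k) := \sum_(x <- s) c_ (a x) *: x.

Definition independent (B : set X) := forall (s : seq X) (a : X -> k),
  uniq s -> {in s, forall x, B x} -> lcomb s a = 0 -> {in s, forall x, a x = 0}.

(** A maximal independent subset of [W] spans it, since otherwise one more element of [W] could be
    added. *)
Lemma basis_exists : exists B : set X,
  [/\ (B `<=` W)%classic, independent B
    & forall w, W w -> exists s a,
        [/\ uniq s, {in s, forall x, B x} & w = lcomb s a]].
Proof.
have [F FP Ftot|B [[BW Bi] Bmax]] :=
  @Zorn_bigcup X (fun B => (B `<=` W)%classic /\ independent B).
  split=> [x [B FB Bx]|s a us sF]; first exact: (FP B FB).1 x Bx.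
  (* The empty list is settled first, since an empty chain has no member to choose. *)
  case: s us sF => // y s us sF.
  (* A finite list taken from the union of a chain lies in a single member. *)
  have [B FB sB] : exists2 B, F B & {in y :: s, forall x, B x}.
    elim: s y {us} sF => [|z s IH] y sF.
      have [B FB By] := sF y (mem_head _ _).
      by exists B => // x; rewrite inE => /eqP ->.
    have [B FB By] := sF y (mem_head _ _).
    have [|B' FB' B's] := IH z; first by move=> x xs; apply: sF; rewrite inE xs orbT.
    have [BB|BB] := Ftot B B' FB FB'; [exists B'|exists B] => // x.
      by rewrite inE => /orP[/eqP ->|/B's //]; apply: BB.
    by rewrite inE => /orP[/eqP -> //|/B's]; apply: BB.
  exact: (FP B FB).2 us sB.
exists B; split=> // w Ww.
apply: contrapT => wB; apply: (Bmax (B `|` [set w])%classic).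
  have Bw : ~ B w.
    move=> Bw; apply: wB; exists [:: w], (fun=> 1); split=> //.
      by move=> x; rewrite inE => /eqP ->.
    by rewrite /lcomb big_seq1 rmorph1 scale1r.
  split; first by move=> x Bx; left.
  by move=> /(_ w (or_intror erefl)).
split; first by move=> x [/BW //|->].
move=> s a us sB sa.
have remB s' : uniq s' -> w \notin s' -> {in s', forall x, (B `|` [set w])%classic x} ->
    {in s', forall x, B x}.
  by move=> us' ws' s'B x xs'; case: (s'B x xs') => // xw; rewrite -xw xs' in ws'.
case: (boolP (w \in s)) => ws; last by apply: Bi => //; apply: remB.
have us' : uniq (rem w s) by apply: rem_uniq.
have ws' : w \notin rem w s by rewrite mem_rem_uniqF.
have s'B : {in rem w s, forall x, B x}.
  by apply: remB => // x /mem_rem; apply: sB.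
have sE : lcomb s a = c_ (a w) *: w + lcomb (rem w s) a.
  by rewrite /lcomb (perm_big _ (perm_to_rem ws)) big_cons.
(* A nonzero coefficient at [w] would express [w] through [B]. *)
have aw : a w = 0.
  apply/eqP; apply/negPn/negP => aw; apply: wB.
  exists (rem w s), (fun x => - (a w)^-1 * a x); split=> //.
  have E : c_ (a w) *: w = - lcomb (rem w s) a.
    by apply/eqP; rewrite -addr_eq0 -sE sa.
  rewrite -[w in LHS]scale1r -(rmorph1 c_) -(mulVf aw) rmorphM -scalerA E.
  rewrite scalerN -scaleNr -rmorphN scaler_sumr; apply: eq_bigr => x _.
  by rewrite scalerA -rmorphM.
move=> x xs; case: (x =P w) => [-> //|/eqP xw].
apply: (Bi _ a us' s'B); first by rewrite -sa sE aw rmorph0 scale0r add0r.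
by rewrite mem_rem_uniq // inE xw.
Qed.

End Basis.

(* Think of [H I] as [R e_I], generated by [g I]; the quotient [H I / US I] is
   the standard module of a strongly quasi-hereditary structure. *)
Section Stratification.
Variables (k : fieldType) (R : pzRingType) (c_ : {rmorphism k -> R}).
Variables (J : finType) (e : J -> R) (t : J -> nat).
Variables (H : J -> lmodType R) (US : forall I, H I -> Prop).
Variables (g : forall I, H I) (eps : forall I, {linear H I -> R^o}).
Hypothesis e_idem : forall I, e I * e I = e I.
Hypothesis e_sum : \sum_I e I = 1.
Hypothesis eps_g : forall I, eps I (g I) = e I.
Hypothesis H_projective : forall I, projective (H I).
Hypothesis US_projective : forall I, exists (U : lmodType R) (u : {linear U -> H I}),
  [/\ projective U, injective u & forall h, US h <-> exists v, u v = h].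
(** Expresses that elements of [US I] factor through indices of strictly higher level. *)
Hypothesis US_kill : forall I (X : lmodType R),
  (forall C, (t I < t C)%N -> forall x : X, e C *: x = 0) ->
  forall (h : H I) (x : X), US h -> (eps I h : R) *: x = 0.
(** Together with [e_diag]: modulo [US I], the part of [H I] at [I] consists of multiples of [g I],
    and other indices occur only at levels below [t I]. *)
Hypothesis e_outer : forall I K, K != I -> (t I <= t K)%N ->
  forall h : H I, US (e K *: h).
Hypothesis e_diag : forall I h, exists a, e I *: h = c_ a *: g I.

Lemma zero_support (X : lmodType R) :
  (forall K (x : X), e K *: x = 0) -> forall x : X, x = 0.
Proof.
by move=> X0 x; rewrite -[x]scale1r -e_sum scaler_suml big1.
Qed.

(** Induction on the support, removing an index [I] of greatest level. A map [Phi] from copies of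
    [H I], one for each basis vector of the part of [X] at [I], accounts for [I]: its cokernel, and
    its kernel modulo copies of the projective [U], are supported on [S :\ I]. *)
Lemma pd_le_support (S : {set J}) (X : lmodType R) :
  (forall I K, I \in S -> (t K < t I)%N -> K \in S) ->
  (forall K (x : X), K \notin S -> e K *: x = 0) ->
  pd_le #|S| X.
Proof.
move Sm: #|S| => m; elim: m S Sm X => [|m IH] S Sm X Sdown XS.
  move/eqP: Sm; rewrite cards_eq0 => /eqP S0; apply: zero_projective.
  by apply: zero_support => K x; apply: XS; rewrite S0 inE.
have [I0 I0S] : exists I0, I0 \in S by apply/card_gt0P; rewrite Sm.
pose I := [arg max_(I > I0 in S) t I].
have [IS Imax] : I \in S /\ forall K, K \in S -> (t K <= t I)%N.
  by rewrite /I; case: arg_maxnP.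
have Sm' : #|S :\ I| = m by move: (cardsD1 I S); rewrite IS Sm => -[].
(* [S :\ I] is still closed under lower levels because [I] has the greatest level. *)
have {}IH (Y : lmodType R) : (forall K (y : Y), K \notin S :\ I -> e K *: y = 0) ->
    pd_le m Y.
  move=> YS; apply: (IH (S :\ I)) => // I' K.
  rewrite !inE => /andP[I'I I'S] KI'; rewrite (Sdown _ _ I'S KI') andbT.
  by apply: contraTneq KI' => ->; rewrite -leqNgt Imax.
have IX C : (t I < t C)%N -> forall x : X, e C *: x = 0.
  by move=> IC x; apply: XS; apply: contraL IC => /Imax; rewrite -leqNgt.
pose W : set X := fun x => e I *: x = x.
have [B [BW Bi Bs]] := basis_exists c_ W.
pose T := {x : X | `[< B x >]}.
have TB (b : T) : B (val b) by case: b => b /= /asboolP.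
have We (b : T) : e I *: val b = val b by apply/BW/TB.
have [U [u [U_projective u_inj uE]]] := US_projective I.
have [D [j [ij jF]]] := power_exists T (H I).
have [D' [j' [ij' jF']]] := power_exists T U.
have hD : projective D by apply: (@power_projective T R (H I) D j).
have hD' : projective D' by apply: (@power_projective T R U D' j').
have jf d : finsupp (j d) by apply/jF; exists d.
have jf' d : finsupp (j' d) by apply/jF'; exists d.
(* [h b] sends the generator [g I] to the basis vector [b], since [eps I (g I) = e I] fixes it. *)
have /choice [h hE] (b : T) : exists h : {linear H I -> X},
    forall y, h y = (eps I y : R) *: val b.
  have [|h hE] := @to_linear R (H I) X (fun y => (eps I y : R) *: val b).
    by move=> a y y'; rewrite linearP scalerDl /= -scalerA.
  by exists h.
have [Phi PhiE] := power_map h jf.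
have [Q [i [p [ii [ps ip]]]]] := image_short_exact Phi.
have [N [n [ni nE]]] := kernel_exists p.
have ker_Phi d : p d = 0 <-> Phi d = 0.
  by rewrite -ip; split=> [->|]; rewrite ?linear0 // -[in RHS](linear0 i) => /ii.
(* [US I] acts as zero on [X], so [D'] embeds in the kernel [N]; the quotient of [N] by [D'] is
   supported on [S :\ I]. *)
have hQ : pd_le m.+1 Q.
  exists N, D, n, p; split=> //.
  have [|u' u'E] := @to_linear R D' (T -> H I) (fun d b => u (j' d b)).
    by move=> a d d'; apply/funext => b; rewrite !linearP.
  have [|u1 u1E] := lift_injective (f := u') ij.
    move=> d; apply/jF; have [s sd] := jf' d.
    by exists s => b bs; rewrite u'E sd ?linear0.
  have [|u2 u2E] := lift_injective (f := u1) ni.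
    move=> d; apply/nE/ker_Phi; rewrite PhiE (@fsumE _ _ _ [::]) ?big_nil // => b _.
    by rewrite hE u1E u'E; apply: US_kill => //; apply/uE; eexists.
  have [||Y [q [qs qE]]] := @quotient_exists R N (fun z => exists d, u2 d = z).
  - by exists 0; rewrite linear0.
  - by move=> a _ _ [d <-] [d' <-]; exists (a *: d + d'); rewrite linearP.
  have uq : short_exact u2 q.
    split=> // d d' /(congr1 (j \o n)) /=; rewrite !u2E !u1E !u'E => dd'.
    by apply: ij'; apply/funext => b; apply: u_inj; apply: (congr1 (@^~ b) dd').
  apply: pd_le_extension uq (pd_le_projective m hD') (IH _ _) => K y KS.
  have [z <-] := qs y; rewrite -linearZ; apply/qE.
  pose f := j (n z).
  have ef b : e K *: j (n z) b = j (n (e K *: z)) b by rewrite !linearZ.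
  have /choice [v vE] b : exists v, u v = e K *: f b.
    apply/uE; move: b.
    (* For [K] other than [I], being outside [S] forces [t I <= t K], so [e_outer] applies. *)
    have [KI|KI] := eqVneq K I; last first.
      move=> b; apply: (e_outer KI); rewrite leqNgt; apply: contra KS => /(Sdown _ _ IS) KS.
      by rewrite !inE KI.
    (* For [K = I] each component is a multiple of [g I]. Since [Phi] kills the whole element, the
       coefficients form a linear relation between basis vectors, hence vanish. *)
    subst K; have /choice [a aE] b' := e_diag (f b').
    have a0 b' : c_ (a b') *: g I = 0.
      have [s us sf] := finsupp_uniq (jf (n z)).
      case: (boolP (b' \in s)) => [b's|/sf fb']; last by rewrite -aE /f fb' scaler0.
      have pnz : p (n z) = 0 by apply/nE; exists z.
      have : Phi (e I *: n z) = 0 by apply/ker_Phi; rewrite linearZ /= pnz scaler0.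
      rewrite PhiE (fsumE us) => [|b bs]; last first.
        by rewrite -linearZ -ef /= sf // scaler0 linear0.
      (* The coefficients are extended by 0 from the basis to all of [X], as [lcomb] expects. *)
      pose a' x := if insub x is Some b then a b else 0.
      have a'E b : a' (val b) = a b by rewrite /a' valK.
      under eq_bigr do rewrite hE -linearZ -ef /= -/f aE linearZ /= eps_g -scalerA We.
      move=> fa; suff -> : a b' = 0 by rewrite rmorph0 scale0r.
      rewrite -a'E; apply: (Bi [seq val b | b <- s]); last exact: map_f.
      - by rewrite map_inj_uniq //; apply: val_inj.
      - by move=> _ /mapP[b _ ->]; apply: TB.
      - by rewrite -fa /lcomb big_map; apply: eq_bigr => b _; rewrite a'E.
    by move=> b; rewrite aE a0; apply/uE; exists 0; rewrite linear0.
  have /jF' [d dE] : finsupp v.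
    have [s sf] := jf (n z).
    by exists s => b /sf fb; apply: u_inj; rewrite vE /f fb scaler0 linear0.
  exists d; apply: ni; apply: ij; apply/funext => b.
  by rewrite u2E u1E u'E dE vE -ef.
(* The cokernel of [Phi]: [I] leaves its support because the basis vectors lie in the image and span
   the part of [X] at [I]. *)
have [||Y [q [qs qE]]] := @quotient_exists R X (fun x => exists y, i y = x).
- by exists 0; rewrite linear0.
- by move=> a _ _ [d <-] [d' <-]; exists (a *: d + d'); rewrite linearP.
have iq : short_exact i q by [].
apply: pd_le_extension iq hQ (pd_leS (IH _ _)) => K y KS.
have [x <-] := qs y; rewrite -linearZ; apply/qE.
have [KI|KI] := eqVneq K I; last first.
  exists 0; rewrite linear0 XS //; apply: contra KS => KS.
  by rewrite !inE KI.
have Wx : W (e K *: x) by rewrite /W KI scalerA e_idem.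
have [s [a [us sB ->]]] := Bs _ Wx.
(* A preimage of the linear combination: at each basis vector of [s], its coefficient times the
   generator [g I]. *)
pose F (b : T) := if val b \in s then c_ (a (val b)) *: g I else 0.
pose s' : seq T := pmap insub s.
have s's : [seq val b | b <- s'] = s.
  rewrite /s' pmap_filter; last by move=> ?; rewrite insubK.
  by apply/all_filterP/allP => b /sB Bb; rewrite /= isSome_insub; apply/asboolP.
have us' : uniq s' by rewrite -(map_inj_uniq val_inj) s's.
have Fs' b : b \notin s' -> F b = 0.
  by rewrite /F -s's mem_map; [case: (b \in s')|apply: val_inj].
have /jF [d dE] : finsupp F by exists s'.
exists (p d); rewrite ip PhiE (fsumE us') => [|b bs']; last first.
  by rewrite dE Fs' // linear0.
rewrite /lcomb -[in RHS]s's big_map !big_seq; apply: eq_bigr => b bs'.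
by rewrite hE dE /F -s's map_f // linearZ /= eps_g -scalerA We.
Qed.

End Stratification.

(** * Representations of a poset *)

Section Representations.
Context {k : fieldType} {d : Order.disp_t} {P : finPOrderType d}.
Implicit Types M N L X Y K : rep k P.

Lemma hom_ext M N (f g : rep_hom M N) : (forall p v, f p v = g p v) -> f = g.
Proof. by move=> fg; apply: hom_eq => p; apply/lfunP. Qed.

Lemma comp_homE M N L (g : rep_hom N L) (f : rep_hom M N) p v :
  comp_hom g f p v = g p (f p v).
Proof. by rewrite comp_lfunE. Qed.

Lemma id_homE M p v : id_hom M p v = v.
Proof. by rewrite id_lfunE. Qed.

Lemma add_homE M N (f g : rep_hom M N) p v : (f + g) p v = f p v + g p v.
Proof. exact: add_lfunE. Qed.

Lemma zero_homE M N p v : (0 : rep_hom M N) p v = 0.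
Proof. exact: zero_lfunE. Qed.

Lemma opp_homE M N (f : rep_hom M N) p v : (- f) p v = - f p v.
Proof. exact: opp_lfunE. Qed.

Lemma sum_homE M N (J : Type) (s : seq J) (p : pred J) (f : J -> rep_hom M N) x v :
  (\sum_(j <- s | p j) f j) x v = \sum_(j <- s | p j) f j x v.
Proof.
by apply: (big_morph (fun g : rep_hom M N => g x v)) => [g g'|];
  [apply: add_homE|apply: zero_homE].
Qed.

Lemma hom_natE M N (f : rep_hom M N) p q (h : (p <= q)%O) v :
  f q (rep_map M h v) = rep_map N h (f p v).
Proof. by rewrite -!comp_lfunE hom_nat. Qed.

Lemma comp_hom_assoc M N L K (f : rep_hom L K) (g : rep_hom N L) (h : rep_hom M N) :
  comp_hom (comp_hom f g) h = comp_hom f (comp_hom g h).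
Proof. by apply: hom_ext => p v; rewrite !comp_homE. Qed.

Lemma comp_idl M N (f : rep_hom M N) : comp_hom (id_hom N) f = f.
Proof. by apply: hom_ext => p v; rewrite comp_homE id_homE. Qed.

Lemma comp_idr M N (f : rep_hom M N) : comp_hom f (id_hom M) = f.
Proof. by apply: hom_ext => p v; rewrite comp_homE id_homE. Qed.

Lemma comp_sumr M N L (J : Type) (s : seq J) (p : pred J) (f : rep_hom N L)
    (g : J -> rep_hom M N) :
  comp_hom f (\sum_(j <- s | p j) g j) = \sum_(j <- s | p j) comp_hom f (g j).
Proof.
apply: hom_ext => x v; rewrite comp_homE !sum_homE linear_sum.
by apply: eq_bigr => j _; rewrite comp_homE.
Qed.

Lemma comp_suml M N L (J : Type) (s : seq J) (p : pred J) (f : J -> rep_hom N L)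
    (g : rep_hom M N) :
  comp_hom (\sum_(j <- s | p j) f j) g = \sum_(j <- s | p j) comp_hom (f j) g.
Proof.
apply: hom_ext => x v; rewrite comp_homE !sum_homE.
by apply: eq_bigr => j _; rewrite comp_homE.
Qed.

Lemma comp_0r M N L (f : rep_hom N L) : comp_hom f (0 : rep_hom M N) = 0.
Proof. by apply: hom_ext => p v; rewrite comp_homE !zero_homE linear0. Qed.

Lemma comp_0l M N L (f : rep_hom M N) : comp_hom (0 : rep_hom N L) f = 0.
Proof. by apply: hom_ext => p v; rewrite comp_homE !zero_homE. Qed.

Lemma to_hom M N (f : forall p, M p -> N p) : (forall p, linear (f p)) ->
  (forall p q (h : (p <= q)%O) v, f q (rep_map M h v) = rep_map N h (f p v)) ->
  exists g : rep_hom M N, forall p v, g p v = f p v.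
Proof.
move=> lf nf; pose F p : {linear M p -> N p} :=
  HB.pack (f p) (GRing.isLinear.Build k (M p) (N p) *:%R (f p) (lf p)).
have nat p q (h : (p <= q)%O) :
    (linfun (F q) \o rep_map M h = rep_map N h \o linfun (F p))%VF.
  by apply/lfunP => v; rewrite !comp_lfunE !lfunE /= nf.
by exists (MkHom nat) => p v; exact: (lfunE (F p) v).
Qed.

Lemma rep_map_irr M p q (h h' : (p <= q)%O) : rep_map M h = rep_map M h'.
Proof. by congr rep_map; apply: bool_irrelevance. Qed.

Lemma rep_map_idE M p (h : (p <= p)%O) v : rep_map M h v = v.
Proof. by rewrite rep_map_id id_lfunE. Qed.

Lemma rep_map_compE M p q r (hpq : (p <= q)%O) (hqr : (q <= r)%O)
    (hpr : (p <= r)%O) v : rep_map M hqr (rep_map M hpq v) = rep_map M hpr v.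
Proof. by rewrite (rep_map_comp M hpq hqr hpr) comp_lfunE. Qed.

Lemma dsum_mapE M N p q (h : (p <= q)%O) v :
  rep_map (dsum M N) h v = (rep_map M h v.1, rep_map N h v.2).
Proof. by rewrite lfunE. Qed.

Lemma dsum_biproduct M N : exists (i1 : rep_hom M (dsum M N))
    (i2 : rep_hom N (dsum M N)) (p1 : rep_hom (dsum M N) M)
    (p2 : rep_hom (dsum M N) N),
  [/\ forall p v, i1 p v = (v, 0), forall p v, i2 p v = (0, v),
      forall p v, p1 p v = v.1 & forall p v, p2 p v = v.2].
Proof.
have [||i1 i1E] := @to_hom M (dsum M N) (fun p v => (v, 0)).
- by move=> p a u v; congr (_, _); rewrite /= scaler0 addr0.
- by move=> p q h v; rewrite dsum_mapE /= linear0.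
have [||i2 i2E] := @to_hom N (dsum M N) (fun p v => (0, v)).
- by move=> p a u v; congr (_, _); rewrite /= scaler0 addr0.
- by move=> p q h v; rewrite dsum_mapE /= linear0.
have [||p1 p1E] := @to_hom (dsum M N) M (fun p v => v.1) => //.
  by move=> p q h v; rewrite dsum_mapE.
have [||p2 p2E] := @to_hom (dsum M N) N (fun p v => v.2) => //.
  by move=> p q h v; rewrite dsum_mapE.
by exists i1, i2, p1, p2.
Qed.

(** The structure maps are indexed by values and not by positions, hence [uniq s]. Starting from
    zero maps on the empty list lets orthogonality hold for all pairs of indices. *)
Lemma biproduct (J : eqType) (F : J -> rep k P) (s : seq J) : uniq s ->
  exists (i : forall j, rep_hom (F j) (\big[dsum/zero_rep]_(j <- s) F j))
         (p : forall j, rep_hom (\big[dsum/zero_rep]_(j <- s) F j) (F j)),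
  [/\ {in s, forall j, comp_hom (p j) (i j) = id_hom (F j)},
      forall j j', j != j' -> comp_hom (p j) (i j') = 0
    & \sum_(j <- s) comp_hom (i j) (p j) = id_hom _].
Proof.
elim: s => [_|j0 s IH /= /andP[j0s us]].
  exists (fun=> 0), (fun=> 0); split=> // [j j' _|]; first exact: comp_0r.
  rewrite big_nil; apply: hom_ext; rewrite big_nil => p v.
  by rewrite zero_homE id_homE [v]thinmx0.
rewrite big_cons; have [i [p [pi pi0 ip]]] := IH us.
set S := \big[dsum/zero_rep]_(j <- s) F j in i p pi pi0 ip *.
have [i1 [i2 [p1 [p2 [i1E i2E p1E p2E]]]]] := dsum_biproduct (F j0) S.
have p1i1 : comp_hom p1 i1 = id_hom _.
  by apply: hom_ext => x v; rewrite comp_homE p1E i1E id_homE.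
have p2i2 : comp_hom p2 i2 = id_hom _.
  by apply: hom_ext => x v; rewrite comp_homE p2E i2E id_homE.
have p1i2 : comp_hom p1 i2 = 0.
  by apply: hom_ext => x v; rewrite comp_homE p1E i2E zero_homE.
have p2i1 : comp_hom p2 i1 = 0.
  by apply: hom_ext => x v; rewrite comp_homE p2E i1E zero_homE.
(* At the new index the maps of the binary sum are transported along [j0 = j]; [eq_axiomK] removes
   the cast below. *)
pose i' j : rep_hom (F j) (dsum (F j0) S) := if @eqP J j0 j is ReflectT e
  then ecast j (rep_hom (F j) (dsum (F j0) S)) e i1 else comp_hom i2 (i j).
pose p' j : rep_hom (dsum (F j0) S) (F j) := if @eqP J j0 j is ReflectT e
  then ecast j (rep_hom (dsum (F j0) S) (F j)) e p1 else comp_hom (p j) p2.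
have i'0 : i' j0 = i1 by rewrite /i'; case: eqP => // e; rewrite eq_axiomK.
have p'0 : p' j0 = p1 by rewrite /p'; case: eqP => // e; rewrite eq_axiomK.
have i'1 j : j0 != j -> i' j = comp_hom i2 (i j) by rewrite /i'; case: eqP.
have p'1 j : j0 != j -> p' j = comp_hom (p j) p2 by rewrite /p'; case: eqP.
have sj j : j \in s -> j0 != j by apply: contraTneq => <-.
have p'i' j j' : j0 != j -> j0 != j' -> comp_hom (p' j) (i' j') = comp_hom (p j) (i j').
  move=> h h'; rewrite p'1 // i'1 // comp_hom_assoc -[comp_hom p2 _]comp_hom_assoc.
  by rewrite p2i2 comp_idl.
exists i', p'; split.
- move=> j; rewrite inE => /orP[/eqP ->|js]; first by rewrite i'0 p'0.
  by rewrite p'i' ?sj // pi.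
- move=> j j'; have [<-|jj0] := eqVneq j0 j; have [<-|j'j0] := eqVneq j0 j'.
  + by move=> /eqP.
  + by rewrite p'0 i'1 // -comp_hom_assoc p1i2 comp_0l.
  + by rewrite p'1 // i'0 comp_hom_assoc p2i1 comp_0r.
  + by rewrite p'i' //; apply: pi0.
rewrite big_cons i'0 p'0; have -> : \sum_(j <- s) comp_hom (i' j) (p' j) = comp_hom i2 p2.
  rewrite -[p2 in RHS]comp_idl -ip comp_suml comp_sumr !big_seq.
  apply: eq_bigr => j js; rewrite i'1 ?sj // p'1 ?sj //.
  by rewrite !comp_hom_assoc.
apply: hom_ext => x [v w].
rewrite add_homE !comp_homE i1E i2E p1E p2E id_homE.
by congr (_, _); rewrite /= ?addr0 ?add0r.
Qed.

Lemma kernel_mapE M N (f : rep_hom M N) p q (h : (p <= q)%O) (v : kernel f p) :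
  vsval (rep_map (kernel f) h v) = rep_map M h (vsval v).
Proof. by rewrite [rep_map _ _]/= !comp_lfunE !lfunE /= vsprojK ?kernel_map_mem. Qed.

Lemma kernel_inclE M N (f : rep_hom M N) p (v : kernel f p) :
  kernel_incl f p v = vsval v.
Proof. by rewrite lfunE. Qed.

Lemma kernel_lift X M N (f : rep_hom M N) (h : rep_hom X M) :
  comp_hom f h = 0 -> exists h', h = comp_hom (kernel_incl f) h'.
Proof.
move=> fh; have hf p v : h p v \in lker (f p).
  by rewrite memv_ker -comp_homE fh zero_homE.
have [||h' h'E] := @to_hom X (kernel f) (fun p v => vsproj (lker (f p)) (h p v)).
- by move=> p a u v; rewrite !linearP.
- move=> p q hpq v; apply: val_inj => /=.
  by rewrite [RHS]kernel_mapE !vsprojK ?hf // hom_natE.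
by exists h'; apply: hom_ext => p v; rewrite comp_homE kernel_inclE h'E vsprojK ?hf.
Qed.

Lemma kernel_comp M N (f : rep_hom M N) : comp_hom f (kernel_incl f) = 0.
Proof.
apply: hom_ext => p v; rewrite comp_homE zero_homE kernel_inclE.
by apply/eqP; rewrite -memv_ker; apply: subvsP.
Qed.

Lemma kernel_incl_inj X M N (f : rep_hom M N) (h h' : rep_hom X (kernel f)) :
  comp_hom (kernel_incl f) h = comp_hom (kernel_incl f) h' -> h = h'.
Proof.
move=> hh; apply: hom_ext => p v; apply: val_inj.
by rewrite -[LHS]kernel_inclE -[RHS]kernel_inclE -!comp_homE hh.
Qed.

(** The complement of [K] is the kernel of [f], and the projection [r] onto it is the identity minus
    [s \o f]. *)
Lemma retract_in_add (G K : rep k P) n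
    (s : rep_hom K (\big[dsum/zero_rep]_(i < n) G))
    (f : rep_hom (\big[dsum/zero_rep]_(i < n) G) K) :
  comp_hom f s = id_hom K -> in_add G K.
Proof.
move=> fs; set X := \big[dsum/zero_rep]_(i < n) G in s f fs *.
exists n, (kernel f); rewrite -/X.
have [i1 [i2 [p1 [p2 [i1E i2E p1E p2E]]]]] := dsum_biproduct K (kernel f).
have fsE p v : f p (s p v) = v by rewrite -comp_homE fs id_homE.
have [|r rE] := @kernel_lift X X K f (id_hom X - comp_hom s f).
  apply: hom_ext => p v; rewrite comp_homE add_homE opp_homE comp_homE id_homE.
  by rewrite linearB /= fsE subrr zero_homE.
have rpE p v : kernel_incl f p (r p v) = v - s p (f p v).
  by rewrite -comp_homE -rE add_homE opp_homE comp_homE id_homE.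
have fk p v : f p (kernel_incl f p v) = 0.
  by rewrite -comp_homE kernel_comp zero_homE.
have ki p : injective (kernel_incl f p).
  by move=> u v; rewrite !kernel_inclE; apply: val_inj.
exists (comp_hom s p1 + comp_hom (kernel_incl f) p2), (comp_hom i1 f + comp_hom i2 r).
split; apply: hom_ext => p v; rewrite comp_homE !add_homE !comp_homE.
  rewrite id_homE p1E p2E i1E i2E; case: v => v w /=.
  rewrite linearD /= fsE fk addr0.
  congr (_, _); rewrite /= ?addr0 ?add0r //.
  by apply: (ki p); rewrite rpE linearD /= fsE fk addr0 addrC addKr.
rewrite id_homE p1E p2E i1E i2E /= addr0 add0r.
by rewrite rpE addrC subrK.
Qed.

Lemma in_add_power (G : rep k P) n : in_add G (\big[dsum/zero_rep]_(i < n) G).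
Proof. exact: (@retract_in_add _ _ n _ _ (comp_idl (id_hom _))). Qed.

(** Writing the identity of [Y] as a sum of maps through [G] is the form that the dual basis lemma
    takes. *)
Lemma in_add_retract (G Y : rep k P) : in_add G Y ->
  exists n (a : 'I_n -> rep_hom Y G) (b : 'I_n -> rep_hom G Y),
    \sum_j comp_hom (b j) (a j) = id_hom Y.
Proof.
move=> [n [Z [f [g [gf _]]]]].
have [i1 [i2 [p1 [p2 [i1E i2E p1E p2E]]]]] := dsum_biproduct Y Z.
have [i [p [_ _ ip]]] := biproduct (fun=> G) (index_enum_uniq 'I_n).
exists n, (fun j => comp_hom (p j) (comp_hom f i1)),
  (fun j => comp_hom p1 (comp_hom g (i j))).
transitivity (comp_hom p1 (comp_hom (comp_hom g (comp_hom (id_hom _) f)) i1)).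
  rewrite -ip comp_suml !comp_sumr comp_suml comp_sumr; apply: eq_bigr => j _.
  by rewrite !comp_hom_assoc.
rewrite comp_idl gf comp_idl; apply: hom_ext => x v.
by rewrite comp_homE i1E p1E id_homE.
Qed.

End Representations.

(** * The modules Hom(G, M) and coordinates on interval modules *)

Section HomModule.
Context {k : fieldType} {d : Order.disp_t} {P : finPOrderType d}.
Implicit Types M N : rep k P.

Local Notation G := (interval_gen k P).
Local Notation L := (Lambda k P).

Definition homG M : Type := rep_hom G M.
HB.instance Definition _ M := GRing.Zmodule.on (homG M).

(** Precomposition is a left action because the product of [Lambda] is composition in the opposite
    order. *)
Definition homG_scale M (a : L) (h : homG M) : homG M := comp_hom h a.

Fact homG_scaleA M a b (h : homG M) :
  homG_scale a (homG_scale b h) = homG_scale (a * b) h.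
Proof. exact: comp_hom_assoc. Qed.
Fact homG_scale1 M : left_id 1 (@homG_scale M).
Proof. by move=> h; apply: comp_idr. Qed.
Fact homG_scaleDr M : right_distributive (@homG_scale M) +%R.
Proof.
by move=> a u v; apply: hom_ext => p x; rewrite add_homE !comp_homE add_homE.
Qed.
Fact homG_scaleDl M (h : homG M) : {morph (@homG_scale M)^~ h : a b / a + b}.
Proof.
by move=> a b; apply: hom_ext => p x; rewrite add_homE !comp_homE add_homE linearD.
Qed.
HB.instance Definition _ M := GRing.Zmodule_isLmodule.Build L (homG M)
  (@homG_scaleA M) (@homG_scale1 M) (@homG_scaleDr M) (@homG_scaleDl M).

Lemma homG_scaleE M (a : L) (h : homG M) : a *: h = comp_hom h a.
Proof. by []. Qed.

Lemma homG_post M N (f : rep_hom M N) :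
  exists g : {linear homG M -> homG N}, forall h, g h = comp_hom f h.
Proof.
apply: to_linear => a u v; apply: hom_ext => p x.
by rewrite !homG_scaleE !(add_homE, comp_homE) linearD.
Qed.

Lemma scal_hom_exists (c : k) M : exists f : rep_hom M M, forall p v, f p v = c *: v.
Proof.
apply: to_hom => [p a u v|p q h v]; last by rewrite linearZ.
by rewrite scalerDr !scalerA mulrC.
Qed.

(** The structure map of the [k]-algebra [Lambda], used for [c_] in the stratification. *)
Definition scal (c : k) : L := sval (cid (scal_hom_exists c G)).

Lemma scalE c p v : (scal c : rep_hom G G) p v = c *: v.
Proof. by rewrite /scal; case: cid. Qed.

Fact scal_additive : zmod_morphism scal.
Proof.
move=> a b; apply: hom_ext => p v.
by rewrite add_homE opp_homE !scalE scalerBl.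
Qed.
Fact scal_multiplicative : monoid_morphism scal.
Proof.
split; first by apply: hom_ext => p v; rewrite scalE scale1r id_homE.
move=> a b; apply: hom_ext => p v.
by rewrite [RHS]comp_homE !scalE scalerA mulrC.
Qed.
HB.instance Definition _ := GRing.isZmodMorphism.Build k L scal scal_additive.
HB.instance Definition _ := GRing.isMonoidMorphism.Build k L scal scal_multiplicative.

Lemma scal_scaleE M c (h : homG M) p v : ((scal c *: h) : rep_hom G M) p v = c *: h p v.
Proof. by rewrite homG_scaleE comp_homE scalE linearZ. Qed.

(** Every [h] is the sum of the [b j \o (a j \o h)], so the maps [a j \o h] are coordinates in
    [Lambda] with respect to the [b j]. *)
Lemma homG_retract_projective M (n : Type) (s : seq n) (a : n -> rep_hom M G)
    (b : n -> rep_hom G M) : \sum_(j <- s) comp_hom (b j) (a j) = id_hom M ->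
  projective (homG M).
Proof.
move=> ba; have /choice [l lE] (j : n) : exists l : {linear homG M -> L^o},
    forall h, l h = comp_hom (a j) h.
  apply: to_linear => c u v; apply: hom_ext => p x.
  rewrite -[RHS]/((comp_hom (comp_hom (a j) u) c + comp_hom (a j) v) p x).
  by rewrite comp_homE !add_homE linearD !comp_homE.
apply: (@dual_basis_projective _ _ s (homG M) b l) => h.
rewrite -[h in LHS]comp_idl -ba comp_suml; apply: eq_bigr => j _.
by rewrite lE homG_scaleE comp_hom_assoc.
Qed.

Lemma in_add_projective M : in_add G M -> projective (homG M).
Proof. by move=> /in_add_retract [n [a [b ba]]]; apply: homG_retract_projective ba. Qed.

End HomModule.

(** * Maps into interval modules as scalar functions *)

Section Coordinates.
Context {k : fieldType} {d : Order.disp_t} {P : finPOrderType d}.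
Implicit Types (M N : rep k P) (I J K C : poset_interval P).

(** The row has length 0 or 1, so the sum is its only entry or 0; this treats points inside and
    outside an interval uniformly. *)
Definition crd (b : bool) (v : 'rV[k]_b) : k := \sum_j v 0 j.

Lemma crdK (b : bool) (v : 'rV[k]_b) : const_mx (crd v) = v.
Proof.
apply/rowP => j; rewrite mxE /crd; case: b v j => v j; last by case: j.
by rewrite big_ord1 [j]ord1.
Qed.

Lemma crd_const (b : bool) (a : k) : crd (const_mx a : 'rV_b) = if b then a else 0.
Proof. by rewrite /crd; case: b; rewrite ?big_ord1 ?big_ord0 ?mxE. Qed.

Lemma crd_linear (b : bool) : scalar (@crd b).
Proof.
move=> a u v; rewrite /crd mulr_sumr -big_split; apply: eq_bigr => j _.
by rewrite !mxE.
Qed.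

Lemma crdD (b : bool) (u v : 'rV[k]_b) : crd (u + v) = crd u + crd v.
Proof. by rewrite -[u in LHS]scale1r crd_linear mul1r. Qed.

Lemma crd_inj (b : bool) : injective (@crd b).
Proof. by move=> u v uv; rewrite -[u]crdK uv crdK. Qed.

Lemma crd0 (b : bool) : crd (0 : 'rV_b) = 0.
Proof. by rewrite /crd big1 // => j _; rewrite mxE. Qed.

Lemma crdZ (b : bool) a (v : 'rV[k]_b) : crd (a *: v) = a * crd v.
Proof. by rewrite -[_ *: _]addr0 crd_linear crd0 addr0. Qed.

Lemma crd_false (b : bool) (v : 'rV[k]_b) : ~~ b -> crd v = 0.
Proof. by case: b v => // v _; rewrite /crd big_ord0. Qed.

Lemma interval_mapE I p q (h : (p <= q)%O) (v : interval_rep k I p) :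
  rep_map (interval_rep k I) h v = const_mx (crd v).
Proof.
rewrite lfunE /=; apply/rowP => j; rewrite !mxE /crd.
apply: eq_bigr => i _; rewrite mxE.
have -> : (i == j :> nat) && (i < 1)%N.
  move: (leq_trans (ltn_ord i) (leq_b1 _)) (leq_trans (ltn_ord j) (leq_b1 _)).
  by rewrite !ltnS !leqn0 => /eqP -> /eqP ->.
by rewrite mulr1.
Qed.

Definition cf N I (f : rep_hom N (interval_rep k I)) x (v : N x) : k :=
  @crd (x \in val I) (f x v).

Lemma cf_ext N I (f g : rep_hom N (interval_rep k I)) :
  (forall x v, cf f v = cf g (x := x) v) -> f = g.
Proof. by move=> fg; apply: hom_ext => p v; apply/crd_inj/fg. Qed.

Lemma cf_out N I (f : rep_hom N (interval_rep k I)) x (v : N x) :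
  x \notin val I -> cf f v = 0.
Proof.
exact: crd_false.
Qed.

Lemma cf_nat N I (f : rep_hom N (interval_rep k I)) x y (h : (x <= y)%O) v :
  y \in val I -> cf f (rep_map N h v) = cf f v.
Proof. by move=> yI; rewrite /cf hom_natE interval_mapE crd_const yI. Qed.

Lemma cf_linear N I (f : rep_hom N (interval_rep k I)) x :
  scalar (@cf N I f x).
Proof. by move=> a u v; rewrite /cf linearP crd_linear. Qed.

Lemma cf_add N I (f g : rep_hom N (interval_rep k I)) x (v : N x) :
  cf (f + g) v = cf f v + cf g v.
Proof. by rewrite /cf add_homE; apply: crdD. Qed.

Lemma cf_zero N I x (v : N x) : cf (0 : rep_hom N (interval_rep k I)) v = 0.
Proof. by rewrite /cf zero_homE crd0. Qed.

Lemma cf_sum N I (J : Type) (s : seq J) (p : pred J)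
    (f : J -> rep_hom N (interval_rep k I)) x (v : N x) :
  cf (\sum_(j <- s | p j) f j) v = \sum_(j <- s | p j) cf (f j) v.
Proof.
by apply: (big_morph (fun g : rep_hom N (interval_rep k I) => cf g v)) => [g g'|];
  [apply: cf_add|apply: cf_zero].
Qed.

Lemma to_cf N I (a : forall x, N x -> k) : (forall x, scalar (a x)) ->
  (forall x v, x \notin val I -> a x v = 0) ->
  (forall x y (h : (x <= y)%O) v, y \in val I -> a y (rep_map N h v) = a x v) ->
  exists f : rep_hom N (interval_rep k I), forall x v, cf f v = a x v.
Proof.
move=> al a0 an.
have [||f fE] := @to_hom k d P N (interval_rep k I)
    (fun x v => (const_mx (a x v) : 'rV[k]_(x \in val I))).
- by move=> x c u v; apply/rowP => j; rewrite !mxE al.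
- move=> x y h v; rewrite interval_mapE crd_const.
  apply: (@crd_inj (y \in val I)); rewrite !crd_const; case: ifP => // yI.
  by rewrite an //; case: ifP => // /negbT /a0 ->.
exists f => x v; rewrite /cf fE crd_const.
by case: ifP => // /negbT /a0 ->.
Qed.

Definition one_at I x : interval_rep k I x := (const_mx 1 : 'rV[k]_(x \in val I)).

Lemma cf_oneE N I (f : rep_hom N (interval_rep k I)) x (v : N x) :
  f x v = cf f v *: one_at I x.
Proof.
apply: (@crd_inj (x \in val I)); rewrite [RHS]crdZ crd_const -/(cf f v).
by case: (boolP (x \in val I)) => [_|xI]; rewrite ?mulr1 // cf_out // mul0r.
Qed.

(** A map between interval modules amounts to one scalar at each point, zero outside the
    intersection; composition multiplies these scalars. *)
Definition scoef I J (f : rep_hom (interval_rep k I) (interval_rep k J)) x : k :=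
  cf f (one_at I x).

Lemma cf_comp N I J (g : rep_hom (interval_rep k I) (interval_rep k J))
    (f : rep_hom N (interval_rep k I)) x (v : N x) :
  cf (comp_hom g f) v = cf f v * scoef g x.
Proof.
rewrite {1}/cf comp_homE (cf_oneE f) linearZ; exact: crdZ.
Qed.

Lemma scoef_comp I J K (g : rep_hom (interval_rep k J) (interval_rep k K))
    (f : rep_hom (interval_rep k I) (interval_rep k J)) x :
  scoef (comp_hom g f) x = scoef f x * scoef g x.
Proof. exact: cf_comp. Qed.

Lemma cf_scoef I J (f : rep_hom (interval_rep k I) (interval_rep k J)) x v :
  cf f v = @crd (x \in val I) v * scoef f x.
Proof. by rewrite -[f in LHS]comp_idr cf_comp /cf id_homE. Qed.

Lemma scoef_id I x : scoef (id_hom (interval_rep k I)) x = (x \in val I)%:R.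
Proof. by rewrite /scoef /cf id_homE crd_const; case: (x \in val I). Qed.

Lemma scoef_supp I J (f : rep_hom (interval_rep k I) (interval_rep k J)) x :
  scoef f x != 0 -> (x \in val I) && (x \in val J).
Proof.
apply: contraNT; rewrite negb_and => /orP[|xJ]; last by rewrite /scoef cf_out.
rewrite /scoef => xI; have -> : one_at I x = 0.
  by apply: (@crd_inj (x \in val I)); rewrite crd0 crd_const (negPf xI).
by rewrite /cf linear0 crd0.
Qed.

Lemma scoef_nat I J (f : rep_hom (interval_rep k I) (interval_rep k J)) x y :
  (x <= y)%O -> x \in val I -> y \in val J -> scoef f y = scoef f x.
Proof.
move=> h xI yJ; rewrite /scoef -(cf_nat f h) // interval_mapE.
by rewrite /one_at crd_const xI.
Qed.

(** [scoef f] does not change along a Hasse edge inside [I], and [I] is connected. *)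
Lemma endo_const I (f : rep_hom (interval_rep k I) (interval_rep k I)) x y :
  x \in val I -> y \in val I -> scoef f x = scoef f y.
Proof.
move=> xI yI; case: I f xI yI => I /= iI f xI yI.
have /and3P[_ /forall_inP cI _] := iI.
have /forall_inP/(_ y yI)/connectP[s sp ->] := cI x xI.
elim: s x xI sp => [|z s IH] x xI //= /andP[/and3P[_ zI e] sp].
rewrite -(IH z) //.
by case/orP: e => /andP[/ltW h _]; [rewrite -(scoef_nat f h)|rewrite (scoef_nat f h)].
Qed.

(** The scalar is the constant value of [scoef f] on [I]; off [I] the fibres are zero. *)
Lemma endo_scalar I (f : rep_hom (interval_rep k I) (interval_rep k I)) :
  exists a : k, forall x v, f x v = a *: v.
Proof.
have [x xI] : exists x, x \in val I.
  by case/and3P: (valP I) => /set0Pn.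
exists (scoef f x) => y v; apply: (@crd_inj (y \in val I)).
rewrite -[LHS]/(cf f v) cf_scoef.
have -> : crd (scoef f x *: v : 'rV_(y \in val I)) = scoef f x * crd (v : 'rV_(y \in val I)).
  exact: crdZ.
have [yI|/negP yI] := pselect (y \in val I); first by rewrite (endo_const f xI yI) mulrC.
suff -> : crd (v : 'rV_(y \in val I)) = 0 by rewrite mul0r mulr0.
exact: crd_false.
Qed.

End Coordinates.

(** * The order on intervals and the bound on the global dimension *)

Section Components.
Context {d : Order.disp_t} {P : finPOrderType d}.
Implicit Types (S : {set P}) (I C : poset_interval P).

Definition within S : rel P := [rel x y | [&& x \in S, y \in S & hasse_edge x y]].

Lemma within_connect_sym S : connect_sym (within S).
Proof.
by apply: sym_connect_sym => x y; rewrite /within /hasse_edge /= andbCA orbC.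
Qed.

(** Induction on the size of the segment from [x] to [y]: unless [y] covers [x], some point lies
    strictly between them, in [S] by convexity, and both subsegments are smaller. *)
Lemma convex_le_connect S x y : poset_convex S -> x \in S -> y \in S ->
  (x <= y)%O -> connect (within S) x y.
Proof.
move=> cS; pose m (x y : P) := #|[set z | (x <= z <= y)%O]|.
have [n] := ubnP (m x y); elim: n x y => // n IH x y mn xS yS xy.
have [->|nxy] := eqVneq x y; first exact: connect0.
have ltxy : (x < y)%O by rewrite lt_neqAle nxy.
have [cxy|] := boolP (covers x y).
  by apply: connect1; rewrite /within /hasse_edge /= xS yS cxy.
rewrite /covers ltxy /= negbK => /existsP[z /andP[xz zy]].
have zS : z \in S.
  move/forall_inP/(_ x xS)/forall_inP/(_ y yS)/forallP/(_ z): cS.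
  by rewrite !ltW.
apply: (@connect_trans _ _ z); apply: IH => //; try exact: ltW;
  apply: leq_trans (ltnSE mn); apply: proper_card; apply/properP; split.
- by apply/fintype.subsetP => w; rewrite !inE => /andP[-> wz]; apply: le_trans wz (ltW zy).
- by exists y; rewrite !inE ?xy ?lexx // (lt_geF zy) andbF.
- by apply/fintype.subsetP => w; rewrite !inE => /andP[zw ->]; rewrite (le_trans (ltW xz)).
- by exists x; rewrite !inE ?xy ?lexx // (lt_geF xz).
Qed.

Definition component S x : {set P} := [set y in S | connect (within S) x y].

Lemma component_interval S x : poset_convex S -> x \in S ->
  is_interval (component S x).
Proof.
move=> cS xS; apply/and3P; split.
- by apply/set0Pn; exists x; rewrite inE xS connect0.
- apply/forall_inP => y; rewrite inE => /andP[yS xy].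
  apply/forall_inP => z; rewrite inE => /andP[zS xz].
  have /connectP[s] : connect (within S) y z.
    by apply: connect_trans xz; rewrite within_connect_sym.
  (* A path in [S] that starts in the component stays in it. *)
  elim: s y yS xy => [|w s IH] y yS xy /=; first by move=> _ ->; apply: connect0.
  move=> /andP[e sp] zE; have /and3P[_ wS e'] := e.
  have xw : connect (within S) x w by apply: connect_trans xy (connect1 e).
  apply: connect_trans (IH w wS xw sp zE); apply: connect1.
  by rewrite /= !inE yS xy wS xw.
- apply/forall_inP => y; rewrite inE => /andP[yS xy].
  apply/forall_inP => z; rewrite inE => /andP[zS xz].
  apply/forallP => w; apply/implyP => /andP[yw wz].
  have wS : w \in S.
    by move/forall_inP/(_ y yS)/forall_inP/(_ z zS)/forallP/(_ w): cS; rewrite yw wz.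
  by rewrite inE wS (connect_trans xy) ?convex_le_connect.
Qed.

Lemma component_closed S x y z : poset_convex S -> y \in component S x ->
  z \in S -> (y <= z)%O || (z <= y)%O -> z \in component S x.
Proof.
move=> cS; rewrite !inE => /andP[yS xy] zS yz; rewrite zS (connect_trans xy) //.
case/orP: yz => h; first exact: convex_le_connect.
by rewrite within_connect_sym convex_le_connect.
Qed.

Lemma component_eq S x y : y \in component S x -> component S x = component S y.
Proof.
rewrite inE => /andP[_ xy]; apply/setP => z; rewrite !inE.
by rewrite (same_connect (@within_connect_sym S) xy).
Qed.

(** The number of elements below [x] makes the rank strictly increasing; the enumeration index,
    smaller than [#|P|], makes it injective without disturbing the order. *)
Definition prank (x : P) : nat := (#|[set y | (y <= x)%O]| * #|P| + enum_rank x)%N.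

Lemma prank_inj : injective prank.
Proof.
move=> x y /(congr1 (modn^~ #|P|)); rewrite !modnMDl !modn_small //.
by move=> /val_inj/enum_rank_inj.
Qed.

Lemma prank_lt x y : (x < y)%O -> (prank x < prank y)%N.
Proof.
move=> xy; rewrite /prank.
have h : (#|[set z | (z <= x)%O]| < #|[set z | (z <= y)%O]|)%N.
  apply: proper_card; apply/properP; split.
    by apply/fintype.subsetP => z; rewrite !inE => /le_trans-> //; apply: ltW.
  by exists y; rewrite !inE ?lexx // (lt_geF xy).
apply: leq_trans (leq_addr _ _).
apply: (@leq_trans (#|[set z | (z <= x)%O]|.+1 * #|P|)%N).
  by rewrite mulSn addnC ltn_add2r.
by rewrite leq_mul2r h orbT.
Qed.

Lemma base_exists : exists q : poset_interval P -> P, forall I,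
  q I \in val I /\ {in val I, forall x, (prank (q I) <= prank x)%N}.
Proof.
suff /choice [q qE] : forall I, exists q,
    q \in val I /\ {in val I, forall x, (prank q <= prank x)%N} by exists q.
move=> I; have /and3P[/set0Pn[x0 x0I] _ _] := valP I.
by exists [arg min_(x < x0 in val I) prank x]; case: arg_minnP.
Qed.

Definition base : poset_interval P -> P := sval (cid base_exists).

Lemma base_in I : base I \in val I.
Proof. by rewrite /base; case: cid => q /= /(_ I)[]. Qed.

Lemma base_min I x : x \in val I -> (prank (base I) <= prank x)%N.
Proof. by rewrite /base; case: cid => q /= /(_ I)[_]; apply. Qed.

Lemma base_minimal I x : x \in val I -> (x <= base I)%O -> x = base I.
Proof.
move=> xI; rewrite le_eqVlt => /orP[/eqP //|/prank_lt].
by rewrite ltnNge base_min.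
Qed.

Definition unbased I : {set P} := val I :\ base I.

(** The base point is minimal in [I], so it cannot lie above another point of [I]. *)
Lemma unbased_convex I : poset_convex (unbased I).
Proof.
apply/forall_inP => y; rewrite !inE => /andP[yb yI].
apply/forall_inP => z; rewrite !inE => /andP[zb zI].
apply/forallP => w; apply/implyP => /andP[yw wz].
rewrite !inE (interval_convex yI zI yw wz) andbT.
by apply: contraNneq yb => wb; apply/eqP/base_minimal; rewrite // -wb.
Qed.

Definition is_component I C := [exists x in unbased I, val C == component (unbased I) x].

Lemma is_componentP I C x : is_component I C -> x \in val C ->
  x \in unbased I /\ val C = component (unbased I) x.
Proof.
move=> /exists_inP[y yI /eqP CE]; rewrite CE => xC; split; last exact: component_eq.
by move: xC; rewrite inE => /andP[].
Qed.

Lemma component_unique I x : x \in unbased I ->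
  exists C, [/\ is_component I C, x \in val C
    & forall C', is_component I C' -> x \in val C' -> C' = C].
Proof.
move=> xI; pose C : poset_interval P :=
  exist (fun S : {set P} => is_interval S) _ (component_interval (unbased_convex I) xI).
exists C; split=> [||C' C'I xC'].
- by apply/exists_inP; exists x.
- by rewrite /= inE xI connect0.
- by apply: val_inj; have [_ ->] := is_componentP C'I xC'.
Qed.

Lemma is_component_sub I C x : is_component I C -> x \in val C ->
  x \in val I /\ x != base I.
Proof.
by move=> CI xC; have [] := is_componentP CI xC; rewrite !inE => /andP[].
Qed.

Lemma is_component_closed I C x y : is_component I C -> x \in val C ->
  y \in val I -> y != base I -> (x <= y)%O || (y <= x)%O -> y \in val C.
Proof.
move=> CI xC yI yb xy; have [_ CE] := is_componentP CI xC.
rewrite CE in xC *; apply: component_closed (unbased_convex I) xC _ xy.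
by rewrite !inE yb.
Qed.

End Components.

(** * A numerical level on intervals *)

Section Level.
Context {k : fieldType} {d : Order.disp_t} {P : finPOrderType d}.
Implicit Types (I J K C : poset_interval P).

Definition reaches K I : Prop :=
  exists f : rep_hom (interval_rep k K) (interval_rep k I), scoef f (base I) != 0.

(** A lexicographic pair: the rank of the base point, then the number of intervals with the same
    base point that reach [I]. This number is at most the number of intervals, hence the [.+1] in
    the factor. *)
Definition level I : nat :=
  (prank (base I) * #|{: poset_interval P}|.+1 +
   #|[set K : poset_interval P | (base K == base I) && `[< reaches K I >]]|)%N.

Lemma level_base I J : (prank (base I) < prank (base J))%N -> (level I < level J)%N.
Proof.
move=> h; apply: leq_trans (leq_addr _ _).
apply: (@leq_trans ((prank (base I)).+1 * #|{: poset_interval P}|.+1)%N).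
  by rewrite /level mulSn addnC ltn_add2r ltnS max_card.
by rewrite leq_mul2r h orbT.
Qed.

Lemma reaches_base K I : reaches K I -> (prank (base K) <= prank (base I))%N.
Proof. by move=> [f /scoef_supp/andP[bK _]]; apply: base_min. Qed.

Lemma reaches_refl I : reaches I I.
Proof. by exists (id_hom _); rewrite scoef_id base_in oner_eq0. Qed.

Lemma reaches_trans I J K : base I = base J -> base J = base K ->
  reaches I J -> reaches J K -> reaches I K.
Proof.
move=> IJ JK [f f0] [g g0]; exists (comp_hom g f).
by rewrite scoef_comp mulf_neq0 // -JK.
Qed.

(* The composite of the two maps is a nonzero scalar, so it is nonzero at every
   point of [I]. *)
Lemma reaches_sub I J : base I = base J -> reaches I J -> reaches J I ->
  val I \subset val J.
Proof.
move=> IJ [f f0] [g g0]; apply/fintype.subsetP => x xI.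
have : scoef (comp_hom g f) x != 0.
  rewrite (endo_const (comp_hom g f) xI (base_in I)) scoef_comp.
  by rewrite mulf_neq0 // IJ.
by rewrite scoef_comp mulf_eq0 negb_or => /andP[/scoef_supp/andP[]].
Qed.

(** For equal base points, whatever reaches [K] reaches [I] by transitivity, while [I] reaches
    itself but not [K]: mutual reaching would force equality by [reaches_sub]. *)
Lemma reaches_level K I : K != I -> reaches K I -> (level K < level I)%N.
Proof.
move=> KI rKI; have := reaches_base rKI; rewrite leq_eqVlt => /orP[/eqP|]; last first.
  exact: level_base.
move=> /prank_inj bKI; rewrite /level bKI ltn_add2l.
apply: proper_card; apply/properP; split.
  apply/fintype.subsetP => L; rewrite !inE => /andP[/eqP bL /asboolP rL].
  by rewrite bL eqxx; apply/asboolP; apply: reaches_trans rL rKI; rewrite ?bL.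
exists I; rewrite !inE eqxx /=; first exact/asboolP/reaches_refl.
apply/asboolP => rIK; case/eqP: KI; apply/val_inj/eqP.
by rewrite finset.eqEsubset !reaches_sub.
Qed.

End Level.

(** * The stratification of [Lambda] by intervals *)

Section GlobalDimension.
Variables (k : fieldType) (d : Order.disp_t) (P : finPOrderType d).
Implicit Types (I J K C : poset_interval P).

Local Notation G := (interval_gen k P).
Local Notation L := (Lambda k P).
Local Notation V := (@interval_rep k d P).

Lemma dependent_choice (T : Type) (F : T -> Type) (Q : forall x, F x -> Prop) :
  (forall x, exists y, Q x y) -> exists f : forall x, F x, forall x, Q x (f x).
Proof. by move=> h; exists (fun x => sval (cid (h x))) => x; case: cid. Qed.

Lemma interval_biproduct : exists (i : forall I, rep_hom (V I) G)
    (p : forall I, rep_hom G (V I)),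
  [/\ forall I, comp_hom (p I) (i I) = id_hom (V I),
      forall I J, I != J -> comp_hom (p I) (i J) = 0
    & \sum_I comp_hom (i I) (p I) = id_hom G].
Proof.
have [i [p [pi pi0 ip]]] := biproduct V (index_enum_uniq (poset_interval P)).
by exists i, p; split=> // I; apply: pi; apply: mem_index_enum.
Qed.

Definition vanishing I (f : homG (V I)) : Prop :=
  forall v : G (base I), cf f v = 0.

(** A component is closed upwards in [I], because the removed base point is minimal; so V_C is a
    submodule of V_I. *)
Lemma component_incl I C : is_component I C ->
  exists j : rep_hom (V C) (V I), forall x, scoef j x = (x \in val C)%:R.
Proof.
move=> CI; have [|||j jE] := @to_cf k d P (V C) I
    (fun x v => @crd k (x \in val C) v).
- by move=> x; apply: crd_linear.
- move=> x v xI; apply: crd_false; apply: contra xI => xC.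
  by have [] := is_component_sub CI xC.
- move=> x y h v yI; rewrite interval_mapE crd_const; case: ifP => // /negbT yC.
  apply/esym/crd_false; apply: contra yC => xC.
  have [xI xb] := is_component_sub CI xC.
  apply: (is_component_closed CI xC yI) => //; last by rewrite h.
  by apply: contraNneq xb => yb; apply/eqP/base_minimal; rewrite // -yb.
exists j => x; rewrite /scoef jE crd_const.
by case: (x \in val C).
Qed.

(** A point outside [C] below a point of [C] is either outside [I] or equal to [base I], and [f] is
    zero in both cases; so cutting [f] down to [C] is natural. *)
Lemma component_restrict I C (f : homG (V I)) : vanishing f -> is_component I C ->
  exists r : homG (V C), forall x v,
    cf r v = if x \in val C then cf f (x := x) v else 0.
Proof.
move=> f0 CI; apply: to_cf => [x a u v|x v /negPf-> //|x y h v yC].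
  by case: ifP => _; rewrite ?cf_linear // mulr0 addr0.
have [yI yb] := is_component_sub CI yC; rewrite yC cf_nat //.
have [xC|xC] := boolP (x \in val C) => //.
have [xI|xI] := boolP (x \in val I); last by rewrite cf_out.
have [xb|xb] := eqVneq x (base I); first by subst x; apply: f0.
by case/negP: xC; apply: (is_component_closed CI yC xI xb); rewrite h orbT.
Qed.

(** Each point of [unbased I] lies in exactly one component, so a single term of the sum survives
    there; at the base point and off [I] both sides are zero. *)
Lemma component_decomposition I : exists (j : forall C, rep_hom (V C) (V I))
    (r : forall C, homG (V I) -> homG (V C)),
  [/\ forall C, is_component I C -> forall x, scoef (j C) x = (x \in val C)%:R,
      forall C f, vanishing f -> is_component I C -> forall x v,
        cf (r C f) v = if x \in val C then cf f (x := x) v else 0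
    & forall f, vanishing f -> f = \sum_(C | is_component I C) comp_hom (j C) (r C f)].
Proof.
(* The families [j] and [r] are made total by the value 0 where nothing is required. *)
have [j jE] : exists j : forall C, rep_hom (V C) (V I),
    forall C, is_component I C -> forall x, scoef (j C) x = (x \in val C)%:R.
  apply: (@dependent_choice _ (fun C => rep_hom (V C) (V I)) (fun C j =>
    is_component I C -> forall x, scoef j x = (x \in val C)%:R)) => C.
  case: (boolP (is_component I C)) => [/component_incl[j jE]|_]; first by exists j.
  by exists 0.
have [r rE] : exists r : forall C, homG (V I) -> homG (V C),
    forall C f, vanishing f -> is_component I C -> forall x v,
      cf (r C f) v = if x \in val C then cf f (x := x) v else 0.
  apply: (@dependent_choice _ (fun C => homG (V I) -> homG (V C)) (fun C r =>
    forall f, vanishing f -> is_component I C -> forall x v,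
      cf (r f) v = if x \in val C then cf f (x := x) v else 0)) => C.
  apply: (@dependent_choice (homG (V I)) (fun=> homG (V C))
    (fun f g => vanishing f -> is_component I C -> forall x v,
      cf g v = if x \in val C then cf f (x := x) v else 0)) => f.
  have [f0|nf0] := pselect (vanishing f); last by exists 0 => /nf0.
  case: (boolP (is_component I C)) => [/(component_restrict f0)[g gE]|_].
    by exists g.
  by exists 0.
exists j, r; split=> // f f0; apply: cf_ext => x v.
rewrite cf_sum; under eq_bigr => C CI do rewrite cf_comp jE // rE //.
have [xI|xI] := boolP (x \in unbased I); last first.
  rewrite big1 => [|C CI]; last first.
    case: ifP => xC; rewrite ?mul0r //.
    by have [xI' _] := is_componentP CI xC; rewrite xI' in xI.
  have [xI'|/cf_out->//] := boolP (x \in val I).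
  move: xI; rewrite !inE xI' andbT negbK => /eqP xb; subst x.
  by rewrite f0.
have [C [CI xC Cu]] := component_unique xI.
rewrite (bigD1 C) //= xC mulr1 big1 ?addr0 // => C' /andP[C'I C'C].
case: ifP => xC'; rewrite ?mul0r //.
by rewrite (Cu C') ?eqxx // in C'C.
Qed.

Lemma vanishing_submodule I : exists (U : lmodType L) (u : {linear U -> homG (V I)}),
  injective u /\ forall f, vanishing f <-> exists v, u v = f.
Proof.
apply: submodule_exists => [v|a f g f0 g0 v]; first exact: cf_zero.
rewrite cf_add g0 addr0; have -> : cf (a *: f) v = cf f ((a : rep_hom G G) (base I) v).
  by rewrite /cf homG_scaleE comp_homE.
exact: f0.
Qed.

(** The submodule is the direct sum of the Hom(G, V_C) over the components [C]. Its dual basis has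
    elements [j C \o p C] and coordinates [i C \o r C]. *)
Lemma vanishing_projective I : exists (U : lmodType L) (u : {linear U -> homG (V I)}),
  [/\ projective U, injective u & forall f, vanishing f <-> exists v, u v = f].
Proof.
have [U [u [iu uE]]] := vanishing_submodule I; exists U, u; split=> //.
have u0 y : vanishing (u y) by apply/uE; exists y.
have [j [r [jE rE dec]]] := component_decomposition I.
have [i [p [pi _ _]]] := interval_biproduct.
have /choice [b bE] C : exists b : U, is_component I C -> u b = comp_hom (j C) (p C).
  case: (boolP (is_component I C)) => CI; last by exists 0.
  have /uE [b bE] : vanishing (comp_hom (j C) (p C) : homG (V I)); last by exists b.
  move=> v; rewrite cf_comp jE //.
  have /negPf -> : base I \notin val C; last by rewrite mulr0.
  by apply/negP => bC; have [_] := is_component_sub CI bC; rewrite eqxx.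
have /choice [l lE] C : exists l : {linear U -> L^o},
    is_component I C -> forall y, l y = comp_hom (i C) (r C (u y)).
  case: (boolP (is_component I C)) => CI; last by exists \0.
  have [|l lE] := @to_linear L U L^o (fun y => comp_hom (i C) (r C (u y))); last by exists l.
  move=> a y z; rewrite -[RHS]/(comp_hom (comp_hom (i C) (r C (u y))) a +
    comp_hom (i C) (r C (u z))).
  (* The chosen [r C] is linear on vanishing maps because its coordinates there are prescribed. *)
  have -> : r C (u (a *: y + z)) = comp_hom (r C (u y)) a + r C (u z).
    apply: cf_ext => x v; rewrite cf_add /cf comp_homE -!/(cf _ _) !rE //.
    case: ifP => _; last by rewrite addr0.
    by rewrite linearP cf_add homG_scaleE /cf comp_homE.
  apply: hom_ext => x v; rewrite add_homE !comp_homE add_homE linearD.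
  by rewrite comp_homE.
apply: (@dual_basis_projective _ _ [seq C <- index_enum _ | is_component I C] U b l) => y.
apply: iu; rewrite big_filter linear_sum {1}(dec _ (u0 y)); apply: eq_bigr => C CI.
rewrite linearZ /= bE // lE // homG_scaleE comp_hom_assoc.
by rewrite -[comp_hom (p C) _]comp_hom_assoc pi comp_idl.
Qed.

(** Apply [pd_le_support] with all intervals as support; the [e I] are the idempotents of the
    summands of [G]. *)
Lemma Lambda_gldim_bound (X : lmodType L) : pd_le #|{: poset_interval P}| X.
Proof.
have [i [p [pi pi0 ip]]] := interval_biproduct.
pose e I : L := comp_hom (i I) (p I).
pose g I : homG (V I) := p I.
have /dependent_choice [eps epsE] I : exists l : {linear homG (V I) -> L^o},
    forall h, l h = comp_hom (i I) h.
  apply: to_linear => a f h; apply: hom_ext => x v.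
  rewrite -[RHS]/((comp_hom (comp_hom (i I) f) a + comp_hom (i I) h) x v).
  by rewrite comp_homE !add_homE linearD !comp_homE.
rewrite -cardsT.
apply: (@pd_le_support k L (@scal k d P) _ e (@level k d P)
  (fun I => homG (V I)) vanishing g eps).
- by move=> I; rewrite -[LHS]/(comp_hom (e I) (e I)) /e comp_hom_assoc
    -[comp_hom (p I) _]comp_hom_assoc pi comp_idl.
- exact: ip.
- by move=> I; rewrite epsE.
- move=> I; apply: (@homG_retract_projective _ _ _ _ unit [:: tt] (fun=> i I) (fun=> p I)).
  by rewrite big_seq1 pi.
- exact: vanishing_projective.
- move=> I Y Y0 h x h0.
  have [j [r [jE rE dec]]] := component_decomposition I.
  (* A vanishing [h] factors through the components [C], so [eps I h] factors through the [e C];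
     products in [Lambda] read opposite to composition. *)
  have -> : (eps I h : L) = \sum_(C | is_component I C)
      (comp_hom (i C) (r C h) : L) * (e C * comp_hom (i I) (comp_hom (j C) (p C))).
    rewrite epsE {1}(dec _ h0) comp_sumr; apply: eq_bigr => C CI.
    rewrite -[RHS]/(comp_hom (comp_hom (comp_hom (i I) (comp_hom (j C) (p C))) (e C))
      (comp_hom (i C) (r C h))).
    rewrite /e !comp_hom_assoc; congr comp_hom; congr comp_hom.
    by rewrite -![comp_hom (p C) (comp_hom (i C) _)]comp_hom_assoc !pi !comp_idl.
  rewrite scaler_suml big1 // => C CI; rewrite -!scalerA Y0 ?scaler0 //.
  (* [base C] lies in [I] and differs from [base I], so it has larger rank. *)
  apply: level_base; have [bC bb] := is_component_sub CI (base_in C).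
  rewrite ltn_neqAle base_min // andbT.
  by apply: contra bb => /eqP/prank_inj ->.
(* If [e K *: h] were nonzero at [base I], then [h \o i K] would show that [K] reaches [I], so [K]
   would have smaller level. *)
- move=> I K KI tIK h v; rewrite homG_scaleE /e -comp_hom_assoc cf_comp.
  apply/eqP; rewrite mulf_eq0; apply/orP; right; apply: contraLR tIK => f0.
  by rewrite -ltnNge; apply: reaches_level KI _; exists (comp_hom h (i K)).
(* [h \o i I] is an endomorphism of V_I, hence a scalar. *)
- move=> I h; have [a aE] := endo_scalar (comp_hom h (i I)).
  exists a; apply: hom_ext => x v; rewrite scal_scaleE homG_scaleE /e.
  by rewrite -comp_hom_assoc comp_homE aE.
- by move=> I K _ _; rewrite inE.
- by move=> K x; rewrite inE.
Qed.

End GlobalDimension.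

(** * Interval resolutions *)

Section Approximations.
Context {k : fieldType} {d : Order.disp_t} {P : finPOrderType d}.
Implicit Types (M N X Y K : rep k P).

Local Notation G := (interval_gen k P).
Local Notation L := (Lambda k P).
Local Notation V := (@interval_rep k d P).

Lemma up_interval (p : P) : is_interval [set x | (p <= x)%O].
Proof.
set S := [set x | (p <= x)%O].
have cS : poset_convex S.
  apply/forall_inP => x; rewrite inE => px; apply/forall_inP => y _.
  by apply/forallP => z; apply/implyP => /andP[xz _]; rewrite inE (le_trans px).
have pS : p \in S by rewrite inE.
apply/and3P; split=> //; first by apply/set0Pn; exists p.
have pc x : x \in S -> connect (within S) p x.
  by move=> xS; apply: convex_le_connect => //; rewrite inE in xS.
apply/forall_inP => x xS; apply/forall_inP => y yS.
apply: connect_trans (pc y yS).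
by have := pc x xS; rewrite within_connect_sym.
Qed.

Definition up (p : P) : poset_interval P := exist (fun S : {set P} => is_interval S) _ (up_interval p).

Lemma in_up p x : (x \in val (up p)) = (p <= x)%O.
Proof. by rewrite inE. Qed.

(* [G] contains the representable functors as summands, so it has a generic
   element at each point. *)
Lemma generic_elements : exists (g : forall p, G p)
    (a : forall p M, M p -> rep_hom G M),
  [/\ forall p M (v : M p), a p M v p (g p) = v,
      forall p M N (f : rep_hom M N) v, comp_hom f (a p M v) = a p N (f p v)
    & forall p M c (u v : M p),
        a p M (c *: u + v) = (scal c *: (a p M u : homG M)) + a p M v].
Proof.
have [i [p [pi _ _]]] := interval_biproduct k P.
pose g x : G x := i (up x) x (one_at (up x) x).
have E x : forall M, exists a : M x -> rep_hom G M, forall v y (w : G y),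
    (forall h : (x <= y)%O, a v y w = cf (p (up x)) w *: rep_map M h v) /\
    (~~ (x <= y)%O -> a v y w = 0).
  move=> M; suff h (v : M x) : exists f : rep_hom G M, forall y (w : G y),
      (forall h : (x <= y)%O, f y w = cf (p (up x)) w *: rep_map M h v) /\
      (~~ (x <= y)%O -> f y w = 0).
    by have /choice [a aE] := h; exists a.
  (* The Yoneda map of [v]: the coordinate of [w] in the summand of [up x] times the transport of
     [v]; [pselect] supplies the proof of [x <= y]. *)
  pose F y (w : G y) : M y := if pselect (x <= y)%O is left h
    then cf (p (up x)) w *: rep_map M h v else 0.
  have FE y (h : (x <= y)%O) w : F y w = cf (p (up x)) w *: rep_map M h v.
    by rewrite /F; case: pselect => // h'; rewrite (rep_map_irr _ h h').
  have F0 y w : ~~ (x <= y)%O -> F y w = 0 by move=> /negP h; rewrite /F; case: pselect.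
  have [||f fE] := @to_hom _ _ _ G M F.
  - move=> y c u w; have [h|h] := boolP (x <= y)%O; last by rewrite !F0 // scaler0 addr0.
    by rewrite !(FE _ h) cf_linear scalerDl scalerA.
  - move=> y z h w; have [xy|xy] := boolP (x <= y)%O.
      have xz := le_trans xy h.
      by rewrite (FE _ xy) (FE _ xz) linearZ /= (rep_map_compE xy h xz) cf_nat // in_up.
    rewrite [F y w]F0 // linear0.
    have [xz|xz] := boolP (x <= z)%O; last by rewrite F0.
    by rewrite (FE _ xz) cf_nat ?in_up // cf_out ?scale0r // in_up.
  exists f => y w; rewrite !fE; split=> [h|]; [exact: FE|exact: F0].
have [a aE] : exists a : forall x M, M x -> rep_hom G M,
    forall x M v y (w : G y),
    (forall h : (x <= y)%O, a x M v y w = cf (p (up x)) w *: rep_map M h v) /\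
    (~~ (x <= y)%O -> a x M v y w = 0).
  exists (fun x M => sval (cid (E x M))) => x M; by case: cid.
exists g, a; split.
- move=> x M v; have [-> //] := aE x M v x (g x).
  rewrite rep_map_idE /g /cf -comp_homE pi id_homE crd_const in_up lexx.
  by rewrite scale1r.
- move=> x M N f v; apply: hom_ext => y w; rewrite comp_homE.
  have [a1 a0] := aE x M v y w; have [b1 b0] := aE x N (f x v) y w.
  have [h|h] := boolP (x <= y)%O; last by rewrite a0 // b0 // linear0.
  by rewrite (a1 h) (b1 h) linearZ /= hom_natE.
- move=> x M c u v; apply: hom_ext => y w; rewrite add_homE scal_scaleE.
  have [a1 a0] := aE x M u y w; have [b1 b0] := aE x M v y w.
  have [c1 c0] := aE x M (c *: u + v) y w.
  have [h|h] := boolP (x <= y)%O; last by rewrite a0 // b0 // c0 // scaler0 addr0.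
  by rewrite (a1 h) (b1 h) (c1 h) linearP scalerDr !scalerA mulrC.
Qed.

(** Take a list in [T] whose span has the greatest dimension; adding another element of [T] cannot
    enlarge the span. *)
Lemma finite_span (W : vectType k) (T : W -> Prop) :
  exists n (b : 'I_n -> W), (forall i, T (b i)) /\
    forall v, T v -> exists c, v = \sum_i c i *: b i.
Proof.
pose Q n := `[< exists2 s : seq W, {in s, forall v, T v} & \dim <<s>> = n >].
have exQ : exists n, Q n by exists 0%N; apply/asboolP; exists [::]; rewrite ?span_nil ?dimv0.
have [|n /asboolP[s sT sn] nmax] := ex_maxnP exQ (m := \dim {:W}).
  by move=> n /asboolP[s _ <-]; apply/dimvS/subvf.
exists (size s), (fun i => s`_i); split=> [i|v Tv]; first by apply/sT/mem_nth.
have vs : v \in <<s>>%VS.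
  have : (<<s>> == <<v :: s>>)%VS.
    rewrite eqEdim span_cons addvSr sn; apply: nmax; apply/asboolP.
    exists (v :: s); last by rewrite span_cons.
    by move=> w; rewrite inE => /orP[/eqP -> //|/sT].
  by move=> /eqP ->; rewrite memv_span // mem_head.
exists (fun i => coord (in_tuple s) i v).
exact: (@coord_span _ _ _ (in_tuple s)).
Qed.

(** Induction over the points: once [h] is matched on [s], the difference vanishes on [s], and its
    value at the next point lies in a space of finite dimension. *)
Lemma homG_finite_span M : exists n (b : 'I_n -> homG M),
  forall h : homG M, exists c : 'I_n -> k, h = \sum_i scal (c i) *: b i.
Proof.
suff [n [b bE]] : exists n (b : 'I_n -> homG M), forall h : homG M,
    exists c : 'I_n -> k, {in enum P, forall p, forall v,
      h p v = (\sum_i scal (c i) *: b i : homG M) p v}.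
  exists n, b => h; have [c cE] := bE h; exists c; apply: hom_ext => p v.
  by rewrite cE // mem_enum.
elim: (enum P) => [|p s [n [b bE]]].
  by exists 0%N, (fun=> 0) => h; exists (fun=> 0).
(* The values at [p] of the maps that vanish on [s]. *)
pose T (w : 'Hom(G p, M p)) := exists2 h : homG M, h p = w &
  {in s, forall q, forall v, h q v = 0}.
have [n' [b' [b'T b'E]]] := finite_span T.
have /choice [B BE] i : exists h : homG M, h p = b' i /\
  {in s, forall q, forall v, h q v = 0} by have [h hp hs] := b'T i; exists h.
pose bb (i : 'I_(n + n')) : homG M :=
  match fintype.split i with inl j => b j | inr j => B j end.
exists (n + n')%N, bb => h.
have [c cE] := bE h.
pose h1 : homG M := \sum_i scal (c i) *: b i.
have [|c' c'E] := b'E ((h - h1 : homG M) p).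
  by exists (h - h1) => // q qs v; rewrite add_homE opp_homE cE // subrr.
pose cc (i : 'I_(n + n')) :=
  match fintype.split i with inl j => c j | inr j => c' j end.
exists cc; have -> : \sum_i scal (cc i) *: bb i = h1 + \sum_j scal (c' j) *: B j.
  rewrite big_split_ord; congr (_ + _); apply: eq_bigr => i _; rewrite /cc /bb.
    by rewrite (unsplitK (inl _ i)).
  by rewrite (unsplitK (inr _ i)).
move=> q; rewrite inE => /orP[/eqP ->|qs] v.
  have -> : h p v = h1 p v + (h - h1 : homG M) p v.
    by rewrite add_homE opp_homE addrC subrK.
  rewrite c'E add_homE; congr (_ + _); rewrite sum_homE sum_lfunE.
  by apply: eq_bigr => i _; rewrite scal_scaleE (BE i).1 scale_lfunE.
rewrite add_homE -cE // sum_homE big1 ?addr0 // => i _.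
by rewrite scal_scaleE (BE i).2 // scaler0.
Qed.

(** Use one copy of [G] for each map in a finite spanning list of Hom(G, M). *)
Lemma approximation_exists M : exists X (f : rep_hom X M),
  in_add G X /\ forall h : rep_hom G M, exists h', h = comp_hom f h'.
Proof.
have [n [b bE]] := homG_finite_span M.
have [i [p [pi pi0 ip]]] := biproduct (fun=> G) (index_enum_uniq 'I_n).
exists (\big[dsum/zero_rep]_(i < n) G), (\sum_j comp_hom (b j) (p j)).
split; first exact: in_add_power.
move=> h; have [c ->] := bE h.
exists (\sum_j comp_hom (i j) (scal (c j))).
rewrite comp_suml; apply: eq_bigr => j _.
rewrite comp_sumr (bigD1 j) //= big1 ?addr0 => [|j' j'j].
  by rewrite comp_hom_assoc -[comp_hom (p j) _]comp_hom_assoc pi ?comp_idl // mem_index_enum.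
by rewrite comp_hom_assoc -[comp_hom (p j) _]comp_hom_assoc pi0 1?eq_sym // comp_0l comp_0r.
Qed.

(** Factorisation can be tested on [G] alone, since the identity of an object of add G is a sum of
    maps through [G]. *)
Lemma right_approxI X M (f : rep_hom X M) : in_add G X ->
  (forall h : rep_hom G M, exists h', h = comp_hom f h') -> right_approx G f.
Proof.
move=> hX fh; split=> // Y g /in_add_retract [n [a [b ba]]].
have /choice [h hE] j := fh (comp_hom g (b j)).
exists (\sum_j comp_hom (h j) (a j)).
rewrite comp_sumr -[g in LHS]comp_idr -ba comp_sumr; apply: eq_bigr => j _.
by rewrite -!comp_hom_assoc hE.
Qed.

(** The universal property eliminates the kernel object, leaving conditions on composites that are
    convenient for splicing. *)
Lemma induces_kernel_approxP X Y M (f : rep_hom X Y) (g : rep_hom Y M) :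
  induces_kernel_approx G f g <->
  [/\ in_add G X, comp_hom g f = 0
    & forall Z (h : rep_hom Z Y), in_add G Z -> comp_hom g h = 0 ->
        exists h', h = comp_hom f h'].
Proof.
split=> [[f' [-> [hX f'h]]]|[hX gf fh]].
  split=> // [|Z h hZ gh]; first by rewrite -comp_hom_assoc kernel_comp comp_0l.
  have [h1 ->] := kernel_lift gh; have [h2 ->] := f'h Z h1 hZ.
  by exists h2; rewrite comp_hom_assoc.
have [f' fE] := kernel_lift gf; exists f'; split=> //; split=> // Z h hZ.
have [|h' h'E] := fh Z (comp_hom (kernel_incl g) h) hZ.
  by rewrite -comp_hom_assoc kernel_comp comp_0l.
by exists h'; apply: (@kernel_incl_inj _ _ _ _ _ _ g); rewrite -comp_hom_assoc -fE.
Qed.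

Lemma in_add_zero : in_add G (@zero_rep k d P).
Proof. by have := in_add_power G 0; rewrite big_ord0. Qed.

Lemma in_add_resolution M : in_add G M -> has_interval_resolution M 0.
Proof.
move=> hM; pose obj i : rep k P := if i is 0%N then M else zero_rep.
pose mp i : rep_hom (obj i.+1) (obj i) := 0.
have kill Z (h : rep_hom Z (@zero_rep k d P)) : h = 0.
  by apply: hom_ext => p v; rewrite [LHS]thinmx0 [RHS]thinmx0.
unshelve eexists (@IntervalResolution k d P M obj (id_hom M) mp _ _ _).
- by split=> // Y g _; exists g; rewrite comp_idl.
- apply/induces_kernel_approxP; split=> [||Z h _].
  + exact: in_add_zero.
  + exact: comp_0r.
  + by rewrite comp_idl => ->; exists 0; rewrite comp_0r.
- move=> i; apply/induces_kernel_approxP; split=> [||Z h _ _].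
  + exact: in_add_zero.
  + exact: comp_0r.
  + by exists 0; rewrite comp_0r; apply: kill.
- by case=> // i _ p v; rewrite /= [v]thinmx0.
Qed.

Lemma interval_resolution_step n X M (f : rep_hom X M) : right_approx G f ->
  has_interval_resolution (kernel f) n -> has_interval_resolution M n.+1.
Proof.
move=> fa [D D0].
pose obj j : rep k P := if j is j'.+1 then ires_obj D j' else X.
pose mp j : rep_hom (obj j.+1) (obj j) :=
  match j return rep_hom (obj j.+1) (obj j) with
  | 0%N => comp_hom (kernel_incl f) (ires_aug D)
  | j'.+1 => ires_map D j'
  end.
unshelve eexists (@IntervalResolution k d P M obj f mp fa _ _).
- by exists (ires_aug D); split=> //; apply: ires_aug_approx.
- case=> [|j]; last exact: ires_map_approx.
  (* Composing the augmentation with the injective [kernel_incl f] does not change which maps it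
     kills. *)
  have /induces_kernel_approxP [h1 h2 h3] := ires_map0_approx D.
  apply/induces_kernel_approxP; split=> //.
    by rewrite /= comp_hom_assoc h2 comp_0r.
  move=> Z h hZ h0; apply: h3 => //.
  by apply: (@kernel_incl_inj _ _ _ _ _ _ f); rewrite comp_0r -comp_hom_assoc.
- by case=> // j jn; apply: D0.
Qed.

(** Hom(G, -) is left exact, and the hypothesis on [f] is surjectivity on the right. *)
Lemma kernel_short_exact X M (f : rep_hom X M) :
  (forall h : rep_hom G M, exists h', h = comp_hom f h') ->
  exists (i : {linear homG (kernel f) -> homG X}) (p : {linear homG X -> homG M}),
    short_exact i p /\ forall h, p h = comp_hom f h.
Proof.
move=> fh; have [i iE] := homG_post (kernel_incl f); have [p pE] := homG_post f.
exists i, p; split=> //; split=> [u v|h|h].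
- by rewrite !iE; apply: kernel_incl_inj.
- by have [h' ->] := fh h; exists h'; rewrite pE.
- split=> [|[h' <-]]; last by rewrite pE iE -comp_hom_assoc kernel_comp comp_0l.
  by rewrite pE => /kernel_lift [h' ->]; exists h'; rewrite iE.
Qed.

(** A [Lambda]-linear section of Hom(G, X) -> Hom(G, M), evaluated at the generic elements, gives a
    section [t] of the approximation [f]; so [M] is a retract of an object of add G. *)
Lemma projective_in_add M : projective (homG M) -> in_add G M.
Proof.
move=> hM; have [X [f [hX fh]]] := approximation_exists M.
have [i [p [[ii ps ip] pE]]] := kernel_short_exact fh.
have [s sE] := splitting_projective hM ps.
have [g [a [ag af aD]]] := generic_elements.
have [||t tE] := @to_hom _ _ _ M X (fun x v => (s (a x M v) : rep_hom G X) x (g x)).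
- move=> x c u v; rewrite aD linearD linearZ add_homE.
  by rewrite [X in X + _]scal_scaleE.
(* Naturality of [t]: [a y G w] is the element of [Lambda] that moves the generic element at [y] to
   [w], and [s] commutes with its action. *)
- move=> x y h v; rewrite -hom_natE; set w := rep_map G h (g x).
  have {1}<- : a y G w y (g y) = w by apply: ag.
  rewrite -comp_homE -[comp_hom _ _]/((a y G w : L) *: s (a x M v)) -linearZ /=.
  by rewrite homG_scaleE af /w hom_natE ag.
have ft : comp_hom f t = id_hom M.
  apply: hom_ext => x v; rewrite comp_homE tE -comp_homE -pE sE id_homE.
  exact: ag.
have [m [a' [b' ba']]] := in_add_retract hX.
have [i' [p' [pi' pi0' ip']]] := biproduct (fun=> G) (index_enum_uniq 'I_m).
apply: (@retract_in_add _ _ _ G M m (\sum_j comp_hom (i' j) (comp_hom (a' j) t))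
  (\sum_j comp_hom f (comp_hom (b' j) (p' j)))).
have -> : id_hom M = \sum_j comp_hom f (comp_hom (b' j) (comp_hom (a' j) t)).
  rewrite -ft -{1}[t]comp_idl -ba' comp_suml comp_sumr.
  by apply: eq_bigr => j _; rewrite comp_hom_assoc.
rewrite comp_suml; apply: eq_bigr => j _.
rewrite comp_sumr (bigD1 j) //= big1 ?addr0 => [|j' j'j].
  rewrite !comp_hom_assoc -[comp_hom (p' j) _]comp_hom_assoc pi' ?mem_index_enum //.
  by rewrite comp_idl.
rewrite !comp_hom_assoc -[comp_hom (p' j) _]comp_hom_assoc pi0' 1?eq_sym //.
by rewrite comp_0l !comp_0r.
Qed.

(** By Schanuel's lemma, passing to the kernel of an approximation lowers the bound by one; at 0 the
    representation itself lies in add G. *)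
Lemma pd_le_interval_resolution n M :
  pd_le n (homG M) -> has_interval_resolution M n.
Proof.
elim: n M => [|n IH] M hM; first exact/in_add_resolution/projective_in_add.
have [X [f [hX fh]]] := approximation_exists M.
have [i [p [ip _]]] := kernel_short_exact fh.
apply: (interval_resolution_step (right_approxI hX fh)); apply: IH.
exact: pd_le_syzygy ip (in_add_projective hX) hM.
Qed.

End Approximations.

Theorem proposition4p5 (k : fieldType) (d : Order.disp_t)
    (P : finPOrderType d) :
  gldim_finite (Lambda k P) /\ interval_resolution_gldim_finite k P.
Proof.
split; first exact: pd_le_gldim_finite (@Lambda_gldim_bound k d P).
exists #|{: poset_interval P}| => M; apply: least_witness.
exact/pd_le_interval_resolution/Lambda_gldim_bound.
Qed.
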